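(* Let $\mathcal{D}\subset\mathbb{R}^N$ be open and bounded, and let $F:\mathbb{R}^N\to\mathbb{R}$ be bounded and uniformly continuous. For each sufficiently small $\epsilon>0$ the two game values $$u_I^\epsilon(x)=\sup_{\sigma_I}\inf_{\sigma_{II}}\mathbb{E}\Big[F\circ\big(X^{\epsilon,x,\sigma_I,\sigma_{II}}\big)_{\tau^{\epsilon,x,\sigma_I,\sigma_{II}}}\Big],\qquad u_{II}^\epsilon(x)=\inf_{\sigma_{II}}\sup_{\sigma_I}\mathbb{E}\Big[F\circ\big(X^{\epsilon,x,\sigma_I,\sigma_{II}}\big)_{\tau^{\epsilon,x,\sigma_I,\sigma_{II}}}\Big]$$ satisfy $u_I^\epsilon=u_{II}^\epsilon=u_\epsilon$ on $\mathbb{R}^N$, where $u_\epsilon$ is the unique bounded Borel solution of $$u_\epsilon=\mathcal{A}_\epsilon u_\epsilon\ \text{ in }\mathcal{D},\qquad u_\epsilon=F\ \text{ in }\mathbb{R}^N\setminus\mathcal{D}.$$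
   Context: Fix an integer $N\ge 2$, $\mathbf p\in[2,\infty)$ and $s\in(\frac12,1)$. $e_1,e_2,\dots$ is the standard basis of $\mathbb{R}^N$, $\angle(y,z)$ the angle between vectors. $\mathrm{d}\mu_s^N(z)=\frac{C(N,s)}{|z|^{N+2s}}\,\mathrm{d}z$ with $C(N,s)=\frac{4^s s\,\Gamma(\frac N2+s)}{\pi^{N/2}\Gamma(1-s)}$. Let $\alpha_{\mathbf p}\in(0,\frac\pi2]$ be the angle such that, with $A_{\mathbf p}=\{|z|=1:\ \angle(e_1,z)<\alpha_{\mathbf p}\}$ and $\sigma$ the surface measure on the unit sphere, $\mathbf p-1=\int_{A_{\mathbf p}}\langle z,e_1\rangle^2\,\mathrm{d}\sigma(z)\big/\int_{A_{\mathbf p}}\langle z,e_2\rangle^2\,\mathrm{d}\sigma(z)$. For $0\le a\le b\le\infty$ and $|y|=1$ let $T_{\mathbf p}^{a,b}(y)=\{z\in\mathbb{R}^N:\ \angle(y,z)<\alpha_{\mathbf p},\ a<|z|<b\}$ and $T_{\mathbf p}^{a,b}=T_{\mathbf p}^{a,b}(e_1)$. For bounded Borel $u$ and $\epsilon>0$ define $$\mathcal{A}_\epsilon u(x)=\frac12\Big(\sup_{|y|=1}⨍_{T_{\mathbf p}^{\epsilon,\infty}(y)}u(x+z)\,\mathrm{d}\mu_s^N(z)+\inf_{|y|=1}⨍_{T_{\mathbf p}^{\epsilon,\infty}(y)}u(x+z)\,\mathrm{d}\mu_s^N(z)\Big),$$ where $⨍_T f\,\mathrm{d}\mu_s^N=\frac{1}{\mu_s^N(T)}\int_T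 f\,\mathrm{d}\mu_s^N$. Rotations: for unit vectors $y\ne\tilde y$, $R_{\tilde y,y}\in SO(N)$ is the orientation preserving rotation in the plane spanned by $y,\tilde y$ with $R_{\tilde y,y}y=\tilde y$; $R_{y,y}=Id_N$; for $\tilde y=-y$ fix any rotation in $SO(N)$ mapping $y$ to $-y$. Game: $(\Omega_1,\mathcal{F}_1,\mathbb{P}_1)$ is the product of $T_{\mathbf p}^{1,\infty}$ with its Borel $\sigma$-algebra and the probability measure $\mu_s^N/\mu_s^N(T_{\mathbf p}^{1,\infty})$, and of $\{1,2\}$ with the uniform probability. $(\Omega,\mathcal{F},\mathbb{P})$ is the countable product of copies of $\Omega_1$, with elements $\omega=\{(z_i,s_i)\}_{i=1}^\infty$. A strategy $\sigma_I=\{\sigma_I^n\}_{n=0}^\infty$ (of player I), respectively $\sigma_{II}=\{\sigma_{II}^n\}_{n=0}^\infty$ (of player II), is a sequence of measurable functions from the space of finite histories $H_n=\mathbb{R}^N\times(\mathbb{R}^N\times\Omega_1)^n$ to the unit sphere $\{|y|=1\}$. Given $x\in\mathbb{R}^N$, $\epsilon\in(0,1)$ and strategies, the process $X_n=X_n^{\epsilon,x,\sigma_I,\sigma_{II}}$ is: $X_0\equiv x$ and, for $n\ge1$, $$X_n=X_{n-1}+\begin{cases}\epsilon R_{\sigma_I^{n-1},e_1}z_n&\text{if }s_n=1\\ \epsilon R_{\sigma_{II}^{n-1},e_1}z_n&\text{if }s_n=2,\end{cases}$$ where $\sigma_I^{n-1},\sigma_{II}^{n-1}$ are evaluated at the history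 $(X_0,(X_1,z_1,s_1),\dots,(X_{n-1},z_{n-1},s_{n-1}))$. The stopping time is $\tau=\tau^{\epsilon,x,\sigma_I,\sigma_{II}}=\min\{n\ge0:\ X_n\notin\mathcal{D}\}$, which is finite $\mathbb{P}$-a.s. *)

(* Defs.v *)
From HB Require Import structures.
From mathcomp Require Import all_boot all_order all_algebra.
From mathcomp Require Import all_classical all_reals all_analysis.
From mathcomp Require Import measurable_realfun.

Set Implicit Arguments.
Unset Strict Implicit.
Unset Printing Implicit Defensive.

Import Order.TTheory GRing.Theory Num.Theory.
Import numFieldNormedType.Exports.

Local Open Scope classical_set_scope.
Local Open Scope ring_scope.

Definition rV_borel_display : measure_display.
Proof. exact: default_measure_display. Qed.

Section rV_borel.
Context {R : realType} {n : nat}.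
Local Notation V := 'rV[R]_n.

Definition rV_borel : set (set V) := <<s [set U : set V | open U] >>.

Let rV_borel0 : rV_borel set0. Proof. exact: sigma_algebra0. Qed.
Let rV_borelC A : rV_borel A -> rV_borel (~` A).
Proof. exact: sigma_algebraC. Qed.
Let rV_borel_bigcup (F : (set V)^nat) :
  (forall i, rV_borel (F i)) -> rV_borel (\bigcup_i F i).
Proof. exact: sigma_algebra_bigcup. Qed.

HB.instance Definition _ := @isMeasurable.Build rV_borel_display V
  rV_borel rV_borel0 rV_borelC rV_borel_bigcup.

Lemma rV_open_measurable (U : set V) : open U -> measurable U.
Proof. by move=> oU; exact: sub_sigma_algebra. Qed.

Lemma rV_continuous_measurable (f : V -> R) :
  continuous f -> measurable_fun setT f.
Proof.
move=> /continuousP cf; apply: (measurability _ (RGenOpens.measurableE R)).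
move=> _ [_ [a [b ->] <-]]; rewrite setTI; apply: rV_open_measurable.
exact/cf/interval_open.
Qed.

Lemma rV_coord_measurable (i : 'I_n) :
  measurable_fun setT (fun x : V => x ord0 i).
Proof. by apply: rV_continuous_measurable; exact: coord_continuous. Qed.

Let box (qk : 'rV[rat]_n * nat) : set V :=
  [set x | forall i, `|ratr (qk.1 ord0 i) - x ord0 i| < qk.2.+1%:R^-1].

Let open_boxE (U : set V) : open U ->
  U = \bigcup_(qk : 'rV[rat]_n * nat)
        (if `[< box qk `<=` U >] then box qk else set0).
Proof.
move=> oU; apply/seteqP; split=> [x Ux|x [qk _]]; last first.
  by case: ifPn => // /asboolP; exact.
have /nbhs_ballP[e /= e0 xeU] : nbhs x U by apply: open_nbhs_nbhs.
have [k ke] : exists k : nat, k.+1%:R^-1 < e / 2.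
  have := near_infty_natSinv_lt (PosNum (divr_gt0 e0 (ltr0Sn R 1))).
  by case=> k _ /(_ k) /= h; exists k; exact: h.
have k0 : (0 : R) < k.+1%:R^-1 by rewrite invr_gt0.
have q_ i : exists q : rat, `|ratr q - x ord0 i| < k.+1%:R^-1.
  have /rat_in_itvoo[q] : x ord0 i - k.+1%:R^-1 < x ord0 i + k.+1%:R^-1.
    by rewrite ltrD2l (lt_trans _ k0)// oppr_lt0.
  by rewrite in_itv/= => /andP[q1 q2]; exists q; rewrite ltr_distl q1 q2.
have [q qP] := choice q_.
exists (\row_i q i, k) => //; rewrite ifT; last first.
  apply/asboolP => y yB; apply: xeU; split => // i j.
  rewrite (ord1 i); have := yB j; have := qP j; rewrite /= mxE => h1 h2.
  rewrite /ball/= (_ : _ - _ =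
    - (ratr (q j) - x ord0 j) + (ratr (q j) - y ord0 j)); last first.
    by rewrite opprB addrA subrK.
  rewrite (le_lt_trans (ler_normD _ _))// normrN.
  by rewrite [e]splitr ltrD// (lt_trans _ ke).
by move=> i; rewrite /= mxE.
Qed.

Lemma measurable_rVP d (T : measurableType d) (f : T -> V) :
  measurable_fun setT f <->
  forall i, measurable_fun setT (fun t => f t ord0 i).
Proof.
split=> [mf i|mf].
  exact: measurableT_comp (rV_coord_measurable i) mf.
apply: (measurability [set U : set V | open U]) => //.
move=> _ [U oU <-]; rewrite setTI (open_boxE oU) preimage_bigcup.
apply: countable_bigcupT_measurable; first exact: countableP.
move=> qk; case: ifPn => _; last by rewrite preimage_set0.
rewrite (_ : _ @^-1` _ = \bigcap_(i in [set: 'I_n])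
   ((fun t => `|ratr (qk.1 ord0 i) - f t ord0 i|) @^-1`
     [set` `]-oo, qk.2.+1%:R^-1[])); last first.
  apply/seteqP; split=> t /= h i; first by move=> _ /=; rewrite in_itv/=.
  by have := h i Logic.I; rewrite /= in_itv.
apply: fin_bigcap_measurable; first exact: finite_finset.
move=> i _; rewrite -[X in measurable X]setTI.
suff : measurable_fun setT (fun t => `|ratr (qk.1 ord0 i) - f t ord0 i|).
  by apply => //; exact: measurable_itv.
by apply: measurableT_comp => //; apply: measurable_funB.
Qed.

End rV_borel.

(* Unlike [pushforward], the measurability proof is an argument, so that the
   measure structure can be inferred. *)
Definition mimage d1 d2 (T1 : measurableType d1) (T2 : measurableType d2)
    (R : realType) (m : set T1 -> \bar R) (f : T1 -> T2)
    (mf : measurable_fun setT f) : set T2 -> \bar R :=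
  pushforward m f.

Section mimage.
Local Open Scope ereal_scope.
Context d1 d2 (T1 : measurableType d1) (T2 : measurableType d2) (R : realType).
Variables (m : {measure set T1 -> \bar R}) (f : T1 -> T2).
Hypothesis mf : measurable_fun setT f.

Let mf_pre A : measurable A -> measurable (f @^-1` A).
Proof. by move=> mA; rewrite -[X in measurable X]setTI; exact: mf. Qed.

Let mimage0 : mimage m mf set0 = 0.
Proof. by rewrite /mimage /pushforward preimage_set0 measure0. Qed.

Let mimage_ge0 A : 0 <= mimage m mf A.
Proof. exact: measure_ge0. Qed.

Let mimage_sigma_additive : semi_sigma_additive (mimage m mf).
Proof.
move=> F mF tF mUF; rewrite /mimage /pushforward preimage_bigcup.
apply: measure_semi_sigma_additive.
- by move=> n; exact: mf_pre.
- apply/trivIsetP => /= i j _ _ ij; rewrite -preimage_setI.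
  by move/trivIsetP : tF => /(_ _ _ _ _ ij) ->//; rewrite preimage_set0.
- by rewrite -preimage_bigcup; exact: mf_pre.
Qed.

HB.instance Definition _ := isMeasure.Build _ _ _ (mimage m mf)
  mimage0 mimage_ge0 mimage_sigma_additive.

End mimage.

Section lebesgue_rV.
Context {R : realType}.

Definition rV_cons n (p : R * 'rV[R]_n) : 'rV[R]_n.+1 :=
  \row_i (if unlift ord0 i is Some j then p.2 ord0 j else p.1).

Definition rV_uncons n (x : 'rV[R]_n.+1) : R * 'rV[R]_n :=
  (x ord0 ord0, \row_j x ord0 (lift ord0 j)).

Lemma rV_consK n : cancel (@rV_cons n) (@rV_uncons n).
Proof.
move=> [a v]; congr (_, _); first by rewrite mxE unlift_none.
by apply/rowP => j; rewrite !mxE liftK.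
Qed.

Lemma rV_unconsK n : cancel (@rV_uncons n) (@rV_cons n).
Proof.
by move=> x; apply/rowP => i; rewrite mxE; case: unliftP => [j|] ->; rewrite ?mxE.
Qed.

Lemma measurable_rV_cons n : measurable_fun setT (@rV_cons n).
Proof.
apply/measurable_rVP => i; case: (unliftP ord0 i) => [j|] ->.
  under eq_fun do rewrite mxE liftK.
  exact: measurableT_comp (rV_coord_measurable j) measurable_snd.
by under eq_fun do rewrite mxE unlift_none; exact: measurable_fst.
Qed.

Lemma measurable_rV_uncons n : measurable_fun setT (@rV_uncons n).
Proof.
apply/measurable_fun_pairP; split; first exact: rV_coord_measurable.
apply/measurable_rVP => i.
rewrite [X in measurable_fun _ X](_ : _ = fun x : 'rV[R]_n.+1 => x ord0 (lift ord0 i)).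
  exact: rV_coord_measurable.
by apply/funext => x; rewrite /= mxE.
Qed.

Section step.
Variables (n : nat) (m : {sigma_finite_measure set 'rV[R]_n -> \bar R}).

Definition lebesgue_rV_step : set 'rV[R]_n.+1 -> \bar R :=
  mimage (lebesgue_measure \x m)%E (@measurable_rV_cons n).

HB.instance Definition _ := Measure.on lebesgue_rV_step.

Let lebesgue_rV_step_sigma_finite : sigma_finite setT lebesgue_rV_step.
Proof.
have /sigma_finiteP[F [TF ndF Foo]] := sigma_finiteT (@lebesgue_measure R).
have /sigma_finiteP[G [TG ndG Goo]] := sigma_finiteT m.
exists (fun k => @rV_uncons n @^-1` (F k `*` G k)).
  apply/seteqP; split => // x _.
  have [k _ Fk] : (\bigcup_i F i) (rV_uncons x).1 by rewrite -TF.
  have [l _ Gl] : (\bigcup_i G i) (rV_uncons x).2 by rewrite -TG.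
  exists (maxn k l) => //; split.
    by move: Fk; exact/subsetPset/ndF/leq_maxl.
  by move: Gl; exact/subsetPset/ndG/leq_maxr.
move=> k; have [mF Fk] := Foo k; have [mG Gk] := Goo k; split.
  rewrite -[X in measurable X]setTI; apply: measurable_rV_uncons => //.
  exact: measurableX.
rewrite /lebesgue_rV_step /mimage /pushforward -comp_preimage.
rewrite (_ : _ \o _ = id); last by apply/funext => p /=; rewrite rV_consK.
by rewrite preimage_id product_measure1E// lte_mul_pinfty// ge0_fin_numE.
Qed.

HB.instance Definition _ := Measure_isSigmaFinite.Build _ _ _
  lebesgue_rV_step lebesgue_rV_step_sigma_finite.

End step.

Fixpoint lebesgue_rV (n : nat) : {sigma_finite_measure set 'rV[R]_n -> \bar R} :=
  if n is n'.+1 then lebesgue_rV_step (lebesgue_rV n') else \d_(0 : 'rV[R]_0).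

End lebesgue_rV.

Section euclidean.
Context {R : realType} {n : nat}.
Implicit Types x y z : 'rV[R]_n.

(* The library's norm on row vectors is the sup norm. *)
Definition dotr x y : R := \sum_i x ord0 i * y ord0 i.
Definition enorm x : R := Num.sqrt (dotr x x).
Definition angle y z : R := acos (dotr y z / (enorm y * enorm z)).
Definition usphere : set 'rV[R]_n := [set y | enorm y = 1].

(* [M] acts on the row vector [x] as [x *m M^T]. *)
Definition mxact (M : 'M[R]_n) x : 'rV[R]_n := x *m M^T.

Definition is_SO (M : 'M[R]_n) : Prop := M *m M^T = 1%:M /\ \det M = 1.

(* [Rot y' y] maps [y] to [y'].  For [y' != y, - y] the last condition, together
   with the first two, says that it is the rotation of the plane spanned by
   [y] and [y']; for [y' = - y] any element of SO(n) mapping [y] to [y'] may be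
   chosen. *)
Definition rotation_family (Rot : 'rV[R]_n -> 'rV[R]_n -> 'M[R]_n) : Prop :=
  forall y' y, usphere y' -> usphere y ->
    [/\ is_SO (Rot y' y),
        mxact (Rot y' y) y = y',
        y' = y -> Rot y' y = 1%:M &
        y' <> - y -> forall z, dotr z y = 0 -> dotr z y' = 0 ->
          mxact (Rot y' y) z = z].

Definition cone (alpha : R) (a b : \bar R) y : set 'rV[R]_n :=
  [set z | angle y z < alpha /\ (a < (enorm z)%:E < b)%E].

Lemma measurable_dotr y : measurable_fun setT (dotr y).
Proof.
apply: measurable_sum => i; apply: measurable_funM => //.
exact: rV_coord_measurable.
Qed.

Lemma measurable_enorm : measurable_fun setT enorm.
Proof.
have msqrt : measurable_fun setT (@Num.sqrt R).
  by apply: continuous_measurable_fun; exact: sqrt_continuous.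
apply: (measurableT_comp msqrt); apply: measurable_sum => i.
by apply: measurable_funM; exact: rV_coord_measurable.
Qed.

Let measurable_invr_ge0 (f : 'rV[R]_n -> R) : (forall x, 0 <= f x) ->
  measurable_fun setT f -> measurable_fun setT (fun x => (f x)^-1).
Proof.
move=> f0 mf; rewrite [X in measurable_fun _ X](_ : _ = fun x => f x `^ (-1)).
  exact: (measurableT_comp (measurable_powR _)).
by apply/funext => x; rewrite powR_inv1.
Qed.

Let measurable_acos : measurable_fun setT (@acos R).
Proof.
apply: (measurability _ (RGenInftyO.measurableE R)) => _ [_ [r ->] <-].
rewrite setTI.
rewrite (_ : _ @^-1` _ = [set t | -1 <= t <= 1 /\ acos t < r] `|`
    (~` `[-1, 1]%classic `&` (if 0 < r then setT else set0))).
  apply: measurableU; last first.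
    apply: measurableI; last by case: ifPn.
    exact: measurableC.
  apply: is_interval_measurable => x y /= [x1 xr] [y1 yr] t /andP[xt ty].
  have t1 : -1 <= t <= 1.
    move: x1 y1 => /andP[x1 _] /andP[_ y1].
    by rewrite (le_trans x1 xt) (le_trans ty y1).
  split => //; apply: le_lt_trans xr.
  rewrite leNgt; apply/negP => ac.
  have : cos (acos t) < cos (acos x).
    by rewrite ltr_cos// in_itv/= acos_ge0//= acos_lepi.
  by rewrite !acosK ?in_itv//= ltNge xt.
apply/seteqP; split => [t|t] /=; rewrite !in_itv/=.
  move=> tr; have [t1|t1] := boolP (-1 <= t <= 1); first by left.
  right; split => //; rewrite ifT//.
  move: tr; rewrite acos.unlock; case: xgetP => //= y _ [_ yt].
  by case/negP: t1; rewrite -yt cos_geN1 cos_le1.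
case=> [[]//|[/negP t1]]; case: ifPn => // r0 _.
rewrite acos.unlock; case: xgetP => //= y _ [_ yt].
by case/negP: t1; rewrite -yt cos_geN1 cos_le1.
Qed.

Lemma measurable_cone alpha a b y : measurable (cone alpha a b y).
Proof.
rewrite /cone (_ : mkset _ =
    (angle y @^-1` `]-oo, alpha[) `&`
    ((EFin \o enorm) @^-1` `]a, b[)); last first.
  by apply/seteqP; split => z /=; rewrite !in_itv.
apply: measurableI; rewrite -[X in measurable X]setTI.
  have : measurable_fun setT (angle y) by
    apply: (measurableT_comp measurable_acos); apply: measurable_funM;
      [exact: measurable_dotr|apply: measurable_invr_ge0 => [x|];
        [by rewrite mulr_ge0 ?sqrtr_ge0|
         by apply: measurable_funM => //; exact: measurable_enorm]].
  by apply => //; exact: measurable_itv.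
have : measurable_fun setT (EFin \o enorm).
  by apply/measurable_EFinP; exact: measurable_enorm.
by apply => //; exact: emeasurable_itv.
Qed.

Definition direction x : 'rV[R]_n := (enorm x)^-1 *: x.

Definition punctured_ball : set 'rV[R]_n := [set x | 0 < enorm x < 1].

Lemma measurable_direction : measurable_fun setT direction.
Proof.
apply/measurable_rVP => i.
rewrite [X in measurable_fun _ X](_ : _ = fun x => (enorm x)^-1 * x ord0 i).
  apply: measurable_funM; last exact: rV_coord_measurable.
  apply: measurable_invr_ge0 => [x|]; first exact: sqrtr_ge0.
  exact: measurable_enorm.
by apply/funext => x; rewrite mxE.
Qed.

Lemma measurable_punctured_ball : measurable punctured_ball.
Proof.
rewrite (_ : punctured_ball = enorm @^-1` `]0, 1[).
  by rewrite -[X in measurable X]setTI; exact: measurable_enorm.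
by apply/seteqP; split => z /=; rewrite in_itv.
Qed.

(* [sigma E = n * |{r w : 0 < r < 1, w in E, |w| = 1}|], which is the measure
   in the polar coordinates formula [dz = r^(n-1) dr dsigma]. *)
Definition sphere_measure : set 'rV[R]_n -> \bar R :=
  mscale n%:R%:nng (mimage (mrestr (lebesgue_rV n) measurable_punctured_ball)
                           measurable_direction).

HB.instance Definition _ := Measure.on sphere_measure.

End euclidean.

Section fractional_measure.
Context {R : realType}.

Definition Gamma_fun (x : R) : R :=
  \int[lebesgue_measure]_(t in `]0, +oo[) (t `^ (x - 1) * expR (- t)).

Lemma Gamma_fun_ge0 x : 0 <= Gamma_fun x.
Proof.
by apply: Rintegral_ge0 => t _; rewrite mulr_ge0 ?powR_ge0 ?expR_ge0.
Qed.

Definition Cns (n : nat) (s : R) : R :=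
  4 `^ s * s * Gamma_fun (n%:R / 2 + s) / (pi `^ (n%:R / 2) * Gamma_fun (1 - s)).

Lemma Cns_ge0 n (s : {posnum R}) : 0 <= Cns n s%:num.
Proof.
by rewrite divr_ge0 ?mulr_ge0 ?powR_ge0 ?Gamma_fun_ge0.
Qed.

Context {n : nat} (s : {posnum R}).

Definition mu_density (z : 'rV[R]_n) : R :=
  Cns n s%:num / enorm z `^ (n%:R + 2 * s%:num).

Definition mu_frac (A : set 'rV[R]_n) : \bar R :=
  (\int[lebesgue_rV n]_(z in A) (mu_density z)%:E)%E.

Let mu_density_ge0 z : 0 <= mu_density z.
Proof. by rewrite divr_ge0 ?Cns_ge0 ?powR_ge0. Qed.

Lemma measurable_mu_density : measurable_fun setT mu_density.
Proof.
apply: measurable_funM => //.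
rewrite [X in measurable_fun _ X](_ : _ =
  fun z : 'rV[R]_n => (enorm z `^ (n%:R + 2 * s%:num)) `^ (-1)).
  apply: (measurableT_comp (measurable_powR _)).
  by apply: (measurableT_comp (measurable_powR _)); exact: measurable_enorm.
by apply/funext => z; rewrite powR_inv1 ?powR_ge0.
Qed.

Let mu_frac0 : mu_frac set0 = 0%E.
Proof. by rewrite /mu_frac integral_set0. Qed.

Let mu_frac_ge0 A : (0 <= mu_frac A)%E.
Proof. by apply: integral_ge0 => z _; rewrite lee_fin. Qed.

Let mu_frac_sigma_additive : semi_sigma_additive mu_frac.
Proof.
move=> F mF tF mUF; rewrite /mu_frac ge0_integral_bigcup//=.
- apply: is_cvg_ereal_nneg_natsum_cond => k _ _.
  by apply: integral_ge0 => z _; rewrite lee_fin.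
- apply/measurable_EFinP; apply: measurable_funTS; exact: measurable_mu_density.
- by move=> z _; rewrite lee_fin.
Qed.

HB.instance Definition _ := isMeasure.Build _ _ _ mu_frac
  mu_frac0 mu_frac_ge0 mu_frac_sigma_additive.

End fractional_measure.

Section operator.
Context {R : realType} {n : nat}.
(* The dimension is [n.+2], i.e. an arbitrary integer [N >= 2]. *)
Local Notation V := 'rV[R]_n.+2.

Definition e1 : V := delta_mx ord0 ord0.
Definition e2 : V := delta_mx ord0 (lift ord0 ord0).

Definition cap (alpha : R) : set V := [set z | usphere z /\ angle e1 z < alpha].

Definition p_angle (p alpha : R) : Prop :=
  0 < alpha <= pi / 2 /\
  p - 1 = (\int[@sphere_measure R n.+2]_(z in cap alpha) (dotr z e1) ^+ 2) /
          (\int[@sphere_measure R n.+2]_(z in cap alpha) (dotr z e2) ^+ 2).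

Definition mu_avg (s : {posnum R}) (T : set V) (f : V -> R) : R :=
  (fine (mu_frac s T))^-1 * \int[mu_frac s]_(z in T) f z.

Definition cone_avg alpha s eps (u : V -> R) (x y : V) : R :=
  mu_avg s (cone alpha eps%:E +oo%E y) (fun z => u (x + z)).

Definition A_op alpha s eps (u : V -> R) (x : V) : R :=
  2^-1 * (sup [set cone_avg alpha s eps u x y | y in usphere] +
          inf [set cone_avg alpha s eps u x y | y in usphere]).

Definition dpp_solution alpha s eps (D : set V) (F u : V -> R) : Prop :=
  [/\ bounded_fun u, measurable_fun setT u,
      forall x, D x -> u x = A_op alpha s eps u x &
      forall x, ~ D x -> u x = F x].

End operator.

Definition seqspace (T : Type) : Type := nat -> T.

Definition seqspace_display : measure_display -> measure_display.
Proof. exact. Qed.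

Section seqspace.
Context d {T : measurableType d}.

HB.instance Definition _ := Pointed.copy (seqspace T) (nat -> T).

Definition seqspace_measurable : set (set (seqspace T)) :=
  <<s \bigcup_i preimage_set_system setT (fun w : seqspace T => w i)
                                    measurable >>.

Let seqspace0 : seqspace_measurable set0. Proof. exact: sigma_algebra0. Qed.
Let seqspaceC A : seqspace_measurable A -> seqspace_measurable (~` A).
Proof. exact: sigma_algebraC. Qed.
Let seqspace_bigcup (G : (set (seqspace T))^nat) :
  (forall i, seqspace_measurable (G i)) -> seqspace_measurable (\bigcup_i G i).
Proof. exact: sigma_algebra_bigcup. Qed.

HB.instance Definition _ := @isMeasurable.Build (seqspace_display d)
  (seqspace T) seqspace_measurable seqspace0 seqspaceC seqspace_bigcup.

(* [P] is the countable product of copies of [Q]: a probability on [seqspace T]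
   is determined by its values on the cylinders. *)
Definition iid_law (R : realType) (P : probability (seqspace T) R)
    (Q : set T -> \bar R) : Prop :=
  forall (k : nat) (A : nat -> set T), (forall i, measurable (A i)) ->
    P [set w | forall i, (i < k)%N -> A i (w i)] = (\prod_(i < k) Q (A i))%E.

End seqspace.

Section game.
Context {R : realType} {n : nat}.
Local Notation V := 'rV[R]_n.+2.

(* One round is a pair [(z, b)], where [b = true] stands for [s = 1] (player I
   moves) and [b = false] for [s = 2].  Jumps are typed in the whole space and
   their law is carried by the cone. *)
Local Notation round := (V * bool)%type.

Section law.
Variables (alpha : R) (s : {posnum R}).
Local Notation T1 := (cone alpha 1%:E +oo%E (@e1 R n)).

Lemma mu_cone_inv_ge0 : 0 <= (fine (mu_frac s T1))^-1.
Proof. by rewrite invr_ge0 fine_ge0. Qed.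

Definition jump_law : set V -> \bar R :=
  mscale (NngNum mu_cone_inv_ge0)
         (mrestr (mu_frac s) (measurable_cone alpha 1%:E +oo%E e1)).

HB.instance Definition _ := Measure.on jump_law.

Definition round_law : set round -> \bar R :=
  (jump_law \x bernoulli_prob 2^-1)%E.

End law.

(* [(X_0, [tuple (X_1, (z_1, s_1)); ...; (X_k, (z_k, s_k))])] *)
Local Notation history k := (V * k.-tuple (V * round))%type.

Definition strategy : Type := forall k, history k -> V.

Definition strategies : set strategy :=
  [set sigma | forall k,
    measurable_fun setT (sigma k) /\
    forall h, usphere (sigma k h)].

Section process.
Variables (Rot : V -> V -> 'M[R]_n.+2) (eps : R) (x : V).
Variables (sI sII : strategy).

(* The history up to time [k] together with [X_k].  Rounds are indexed from 0:
   the step from [X_k'] to [X_(k'.+1)] uses [w k']. *)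
Fixpoint play (w : seqspace round) (k : nat) : history k * V :=
  match k with
  | 0 => ((x, [tuple]), x)
  | k'.+1 =>
      let: (h, X) := play w k' in
      let: (z, b) := w k' in
      let y := if b then sI h else sII h in
      let X' := X + eps *: mxact (Rot y e1) z in
      ((h.1, [tuple of rcons h.2 (X', (z, b))]), X')
  end.

Definition position (w : seqspace round) (k : nat) : V := (play w k).2.

Definition exit_time (D : set V) (w : seqspace round) : option nat :=
  match pselect (exists k, `[< ~ D (position w k) >]) with
  | left ex => Some (ex_minn ex)
  | right _ => None
  end.

(* The value on the null event that the game never stops is irrelevant. *)
Definition payoff (D : set V) (F : V -> R) (w : seqspace round) : R :=
  if exit_time D w is Some k then F (position w k) else 0.

End process.

Section values.
Variables (P : probability (seqspace round) R).
Variables (Rot : V -> V -> 'M[R]_n.+2) (eps : R).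
Variables (D : set V) (F : V -> R) (x : V).

Definition expected_payoff (sI sII : strategy) : \bar R :=
  'E_P[payoff Rot eps x sI sII D F]%E.

Definition value_I : \bar R :=
  ereal_sup [set ereal_inf [set expected_payoff sI sII | sII in strategies]
            | sI in strategies].

Definition value_II : \bar R :=
  ereal_inf [set ereal_sup [set expected_payoff sI sII | sI in strategies]
            | sII in strategies].

End values.
End game.

(* Main.v *)
Require Import Defs.
From HB Require Import structures.
From mathcomp Require Import all_boot all_order all_algebra.
From mathcomp Require Import all_classical all_reals all_analysis.
From mathcomp Require Import measurable_realfun ring lra.

Set Implicit Arguments.
Unset Strict Implicit.
Unset Printing Implicit Defensive.

Import Order.TTheory GRing.Theory Num.Theory.
Import numFieldNormedType.Exports.

Local Open Scope classical_set_scope.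
Local Open Scope ring_scope.

(** The proof works for every [eps > 0]; write [c u x y] for the average of [u]
    over [x + T], where [T] is the cone of axis [y] beyond radius [eps].

    Two facts about cones drive everything.  First, Lebesgue measure is
    multiplied by a constant under a similarity and the density of [mu_frac] is
    homogeneous, so [z |-> eps R z] carries the normalised law on the reference
    cone to the normalised law on the cone of axis [R e1]; hence [c u x y] is
    the expectation of [u] after one move in direction [y] ([mu_avgE]).  Second,
    a dilation also shows that a jump longer than any given bound has positive
    probability, so from every point of the bounded set [D] and in every
    direction a move stays in [D] with probability at most some [th < 1]
    ([exit_prob]).

    The second fact makes [u |-> A_op u] a contraction of factor [th] for
    functions prescribed off [D].  This gives uniqueness ([dpp_unique]), and
    existence ([dpp_exists]) by squeezing a solution between the iterates of a
    subsolution and of a supersolution.  Borel measurability of the supremum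
    over the sphere is obtained by reducing it to countably many axes, which is
    possible because [c u x y] depends continuously on [y]
    ([cone_avg_approx]); the same reduction provides measurable almost optimal
    directions ([near_optimal]).

    For the game, a player who always picks an almost optimal direction at the
    current position secures [u x] up to a small error.  Along the play,
    [u (X_k)] stopped at the exit loses at most [eta] per round in expectation
    ([stopped_step]), and the game is still running after [k] rounds with
    probability at most [th ^ k], so that the total loss is at most
    [eta / (1 - th)] and the stopped process converges to the payoff
    ([payoff_ge]).  Applied to [u] and [F] for the first player and to [- u] and
    [- F] for the second, this yields [u <= value_I] and [value_II <= u], while
    [value_I <= value_II] always holds ([game_values]).  The one-step
    expectations rest on the independence of a round from the past
    ([iid_next_integral]) and on the joint measurability of [Rot y e1 z] in [y]
    and [z], for which the rotation is written as a product of two Householder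
    reflections ([rotation_formula], [measurable_rotation]). *)

(** * Lebesgue measure under similarities *)

Section rV_lebesgue.
Context {R : realType}.
Local Notation lam n := (@lebesgue_rV R n).

Lemma lebesgue_measure_shift (a : R) (A : set R) : measurable A ->
  lebesgue_measure ((fun x : R => x + a) @^-1` A) = lebesgue_measure A.
Proof.
have mshift : measurable_fun setT ((fun x => x + a) : measurableTypeR R ->
  measurableTypeR R).
  by apply: measurable_funD.
move=> mA; pose m := mimage (@lebesgue_measure R) mshift.
apply/esym; change (lebesgue_measure A = m A).
apply: lebesgue_measure_unique => // _ [[b c]] _ <- /=.
rewrite /m /mimage /pushforward (_ : _ @^-1` _ = `]b - a, c - a]%classic).
  rewrite !lebesgue_measure_itv/= !lte_fin ltrD2r.
  by case: ifPn => //; rewrite -!EFinB (_ : c - a - (b - a) = c - b)//; lra.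
apply/seteqP; split => x /=; rewrite !in_itv/= => /andP[h1 h2]; apply/andP; lra.
Qed.

Lemma measurable_rVD n d (T : measurableType d) (f g : T -> 'rV[R]_n) :
  measurable_fun setT f -> measurable_fun setT g ->
  measurable_fun setT (fun x => f x + g x).
Proof.
move=> /measurable_rVP mf /measurable_rVP mg; apply/measurable_rVP => i.
by under eq_fun do rewrite mxE; exact: measurable_funD.
Qed.

Lemma measurable_rVN n d (T : measurableType d) (f : T -> 'rV[R]_n) :
  measurable_fun setT f -> measurable_fun setT (fun x => - f x).
Proof.
move=> /measurable_rVP mf; apply/measurable_rVP => i.
by under eq_fun do rewrite mxE; exact: measurableT_comp.
Qed.

Lemma measurable_rVZ n d (T : measurableType d) (a : T -> R) (f : T -> 'rV[R]_n) :
  measurable_fun setT a -> measurable_fun setT f ->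
  measurable_fun setT (fun x => a x *: f x).
Proof.
move=> ma /measurable_rVP mf; apply/measurable_rVP => i.
by under eq_fun do rewrite mxE; exact: measurable_funM.
Qed.

Lemma measurable_rV_shift n (v : 'rV[R]_n) :
  measurable_fun setT (fun x : 'rV[R]_n => x + v).
Proof. exact: measurable_rVD. Qed.

(** By induction on the dimension: the translate of the product measure agrees with
    the product measure on rectangles. *)
Lemma lebesgue_rV_shift n (v : 'rV[R]_n) (A : set 'rV[R]_n) : measurable A ->
  lam n ((fun x => x + v) @^-1` A) = lam n A.
Proof.
elim: n => [|n IHn] in v A *.
  by move=> _; rewrite (_ : _ @^-1` _ = A)//; apply/seteqP; split => x /=;
    rewrite (_ : x + v = x)//; apply/rowP => -[].
move=> mA /=; rewrite /lebesgue_rV_step /mimage /pushforward.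
have mcA : measurable (@rV_cons R n @^-1` A).
  by rewrite -[X in measurable X]setTI; exact: measurable_rV_cons.
pose w := (rV_uncons v).2.
pose sh (p : R * 'rV[R]_n) := (p.1 + v ord0 ord0, p.2 + w).
have msh : measurable_fun setT (sh : measurableTypeR R * _ -> measurableTypeR R * _).
  apply/measurable_fun_pairP; split; first exact: measurable_funD.
  exact: measurable_rVD.
rewrite (_ : _ @^-1` _ = sh @^-1` (@rV_cons R n @^-1` A)); last first.
  apply/seteqP; split => -[a x] /=; rewrite (_ : rV_cons _ + v = rV_cons (sh (a, x)))//;
   by apply/rowP => i; rewrite !mxE; case: unliftP => [j|] -> //; rewrite !mxE.
pose m := mimage (@lebesgue_measure R \x lam n)%E msh.
apply/esym; change ((lebesgue_measure \x lam n)%E (@rV_cons R n @^-1` A) = m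
  (@rV_cons R n @^-1` A)).
apply: product_measure_unique => // B C mB mC.
change ((lebesgue_measure \x lam n)%E (((fun x => x + v ord0 ord0)%R @^-1` B) `*`
  ((fun x => x + w)%R @^-1` C)) = (lebesgue_measure B * lam n C)%E).
have mB' : measurable ((fun x : measurableTypeR R => x + v ord0 ord0) @^-1` B).
  by rewrite -[X in measurable X]setTI; apply: measurable_funD.
have mC' : measurable ((fun x : 'rV_n => x + w) @^-1` C).
  by rewrite -[X in measurable X]setTI; apply: measurable_rV_shift.
rewrite product_measure1E//; congr (_ * _)%E; last exact: IHn.
exact: lebesgue_measure_shift.
Qed.

Local Open Scope ereal_scope.

Lemma integral_lebesgue_rV_shift n (v : 'rV[R]_n) (f : 'rV[R]_n -> \bar R) :
  measurable_fun setT f -> (forall x, 0 <= f x) ->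
  \int[lam n]_x f (x + v)%R = \int[lam n]_x f x.
Proof.
move=> mf f0.
transitivity (\int[mimage (lam n) (measurable_rV_shift v)]_x f x).
  by rewrite ge0_integral_pushforward//; exact: measurable_rV_shift.
by apply: eq_measure_integral => A mA _; exact: lebesgue_rV_shift.
Qed.

(** The classical argument for the uniqueness of a translation invariant measure:
    both sides are the double integral of [f (L x) * g (L x + y)], in which
    either [y] is translated by [L x], or [x] is translated by [K y] and then [y]
    by [L x]. *)
Lemma lebesgue_rV_additive_swap n (L K : 'rV[R]_n -> 'rV[R]_n)
    (f g : 'rV[R]_n -> \bar R) :
  measurable_fun setT L -> (forall x y, L (x + y) = L x + L y)%R ->
  cancel K L ->
  measurable_fun setT f -> (forall x, 0 <= f x) ->
  measurable_fun setT g -> (forall x, 0 <= g x) ->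
  (\int[lam n]_x f (L x)) * (\int[lam n]_x g x) =
  (\int[lam n]_x f (- x)%R) * (\int[lam n]_x g (L x)).
Proof.
move=> mL LD KL mf f0 mg g0.
have mfL : measurable_fun setT (fun x => f (L x)) by exact: measurableT_comp.
have mgL : measurable_fun setT (fun x => g (L x)) by exact: measurableT_comp.
have mfN : measurable_fun setT (fun x : 'rV[R]_n => f (- x)%R).
  by apply: (measurableT_comp mf); exact: measurable_rVN.
have mgD v : measurable_fun setT (fun y : 'rV[R]_n => g (v + y)%R).
  exact: (measurableT_comp mg (measurable_rVD (measurable_cst v) (@measurable_id _ _
    setT))).
have mfD v : measurable_fun setT (fun y : 'rV[R]_n => f (v - y)%R).
  exact: (measurableT_comp mf (measurable_rVD (measurable_cst v) (measurable_rVN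
    (@measurable_id _ _ setT)))).
pose h (p : 'rV[R]_n * 'rV[R]_n) := f (L p.1) * g (L p.1 + p.2)%R.
have mh : measurable_fun setT h.
  apply: emeasurable_funM; first exact: (measurableT_comp mfL).
  apply: (measurableT_comp mg); apply: measurable_rVD => //.
  exact: (measurableT_comp mL).
have h0 p : 0 <= h p by exact: mule_ge0.
rewrite -ge0_integralZr//; last exact: integral_ge0.
transitivity (\int[lam n]_x \int[lam n]_y h (x, y)).
  apply: eq_integral => x _; rewrite /h /=.
  rewrite ge0_integralZl//.
  congr (_ * _); under [RHS]eq_integral do rewrite addrC.
  by rewrite integral_lebesgue_rV_shift.
rewrite (fubini_tonelli h)//.
(* The integrand after the translation of [x] by [- K y]. *)
pose h' (p : 'rV[R]_n * 'rV[R]_n) := f (L p.1 - p.2)%R * g (L p.1).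
have mh' : measurable_fun setT h'.
  apply: emeasurable_funM; last exact: (measurableT_comp mgL).
  apply: (measurableT_comp mf); apply: measurable_rVD.
    exact: (measurableT_comp mL).
  exact: measurable_rVN.
have h'0 p : 0 <= h' p by exact: mule_ge0.
transitivity (\int[lam n]_y \int[lam n]_x h' (x, y)).
  apply: eq_integral => y _; rewrite /h /h' /=.
  rewrite -(integral_lebesgue_rV_shift (- K y)%R); last 2 first.
  - apply: emeasurable_funM => //; apply: (measurableT_comp mg).
    exact: measurable_rVD.
  - by move=> x; exact: mule_ge0.
  apply: eq_integral => x _.
  rewrite (_ : L (x - K y) = L x - y)%R ?subrK//; apply: (addIr y).
  by rewrite subrK -{2}(KL y) -LD subrK.
rewrite -(fubini_tonelli h')// -ge0_integralZl//; last exact: integral_ge0.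
apply: eq_integral => x _; rewrite /h' /=.
rewrite ge0_integralZr//.
congr (_ * _).
rewrite -[RHS](integral_lebesgue_rV_shift (- L x)%R) //.
by apply: eq_integral => y _; rewrite opprB.
Qed.

End rV_lebesgue.

(** * Euclidean norm and balls *)

Section euclid.
Context {R : realType} {n : nat}.
Implicit Types x y z : 'rV[R]_n.

Lemma dotrC x y : dotr x y = dotr y x.
Proof. by apply: eq_bigr => i _; rewrite mulrC. Qed.

Lemma dotrDl x y z : dotr (x + y) z = dotr x z + dotr y z.
Proof. by rewrite -big_split; apply: eq_bigr => i _; rewrite mxE mulrDl. Qed.

Lemma dotrZl a x y : dotr (a *: x) y = a * dotr x y.
Proof. by rewrite mulr_sumr; apply: eq_bigr => i _; rewrite mxE mulrA. Qed.

Lemma dotrDr x y z : dotr z (x + y) = dotr z x + dotr z y.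
Proof. by rewrite !(dotrC z) dotrDl. Qed.

Lemma dotrZr a x y : dotr y (a *: x) = a * dotr y x.
Proof. by rewrite !(dotrC y) dotrZl. Qed.

Lemma dotrNl x y : dotr (- x) y = - dotr x y.
Proof. by rewrite -scaleN1r dotrZl mulN1r. Qed.

Lemma dotrNr x y : dotr y (- x) = - dotr y x.
Proof. by rewrite !(dotrC y) dotrNl. Qed.

Lemma dotrBl x y z : dotr (x - y) z = dotr x z - dotr y z.
Proof. by rewrite dotrDl dotrNl. Qed.

Lemma dotrBr x y z : dotr z (x - y) = dotr z x - dotr z y.
Proof. by rewrite dotrDr dotrNr. Qed.

Lemma dotr_ge0 x : 0 <= dotr x x.
Proof. by apply: sumr_ge0 => i _; rewrite -expr2 sqr_ge0. Qed.

Lemma enorm_ge0 x : 0 <= enorm x. Proof. exact: sqrtr_ge0. Qed.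

Lemma enorm_sqr x : enorm x ^+ 2 = dotr x x.
Proof. by rewrite sqr_sqrtr// dotr_ge0. Qed.

Lemma dotr_eq0 x : dotr x x = 0 -> x = 0.
Proof.
move=> /eqP; rewrite psumr_eq0 => [/allP h|i _]; last by rewrite -expr2 sqr_ge0.
apply/rowP => i; rewrite mxE; apply/eqP.
by have := h i; rewrite mem_index_enum /= mulf_eq0 orbb => /(_ isT).
Qed.

Lemma enorm0 : enorm (0 : 'rV[R]_n) = 0.
Proof.
by rewrite /enorm (_ : dotr 0 0 = 0) ?sqrtr0// /dotr big1// => i _; rewrite mxE mul0r.
Qed.

Lemma enorm_eq0 x : enorm x = 0 -> x = 0.
Proof. by move=> h; apply: dotr_eq0; rewrite -enorm_sqr h expr0n. Qed.

Lemma enormZ a x : enorm (a *: x) = `|a| * enorm x.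
Proof.
by rewrite /enorm dotrZl dotrZr mulrA -expr2 sqrtrM ?sqr_ge0// sqrtr_sqr.
Qed.

Lemma cauchy_schwarz x y : `|dotr x y| <= enorm x * enorm y.
Proof.
rewrite -(@ler_pXn2r _ 2) ?nnegrE ?mulr_ge0 ?enorm_ge0//.
rewrite real_normK ?num_real// exprMn !enorm_sqr.
have [y0|y0] := eqVneq (dotr y y) 0.
  by rewrite (dotr_eq0 y0) -(scale0r 0) !dotrZr !mul0r expr0n mulr0.
have y0' : 0 < dotr y y by rewrite lt_def y0 dotr_ge0.
have := dotr_ge0 (dotr y y *: x - dotr x y *: y).
rewrite !(dotrBl, dotrBr, dotrZl, dotrZr) (dotrC y x) => h.
have {}h : 0 <= dotr y y * (dotr x x * dotr y y - dotr x y ^+ 2) by nra.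
by rewrite -subr_ge0 -(pmulr_rge0 _ y0').
Qed.

Lemma coord_le_enorm x i : `|x ord0 i| <= enorm x.
Proof.
rewrite -(@ler_pXn2r _ 2) ?nnegrE ?enorm_ge0// enorm_sqr real_normK ?num_real//.
rewrite /dotr (bigD1 i)//= expr2 lerDl; apply: sumr_ge0 => j _.
by rewrite -expr2 sqr_ge0.
Qed.

End euclid.

Section ball.
Context {R : realType}.
Local Notation lam n := (@lebesgue_rV R n).

Let box n (r : R) : set 'rV[R]_n := [set x | forall i, `|x ord0 i| < r].

Lemma measurable_box n r : measurable (@box n r).
Proof.
rewrite (_ : box r = \bigcap_(i in [set: 'I_n])
   ((fun x => `|x ord0 i|) @^-1` [set` `]-oo, r[])); last first.
  apply/seteqP; split=> t /= h i; first by move=> _ /=; rewrite in_itv/=.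
  by have := h i Logic.I; rewrite /= in_itv.
apply: fin_bigcap_measurable; first exact: finite_finset.
move=> i _; rewrite -[X in measurable X]setTI.
suff : measurable_fun setT (fun t : 'rV[R]_n => `|t ord0 i|).
  by apply => //; exact: measurable_itv.
by apply: measurableT_comp => //; exact: rV_coord_measurable.
Qed.

Lemma lebesgue_box n r : 0 < r -> lam n (box r) = ((2 * r) ^+ n)%:E.
Proof.
move=> r0; elim: n => [|n IHn].
  by rewrite /= diracE mem_set ?expr0//= => -[].
rewrite /= /lebesgue_rV_step /mimage /pushforward.
rewrite (_ : _ @^-1` _ = `]-r, r[%classic `*` @box n r); last first.
  apply/seteqP; split => -[a x] /=.
    move=> h; split; first by have := h ord0;
      rewrite mxE unlift_none/= in_itv/= ltr_norml.
    by move=> i; have := h (lift ord0 i); rewrite mxE liftK.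
  move=> [/=]; rewrite in_itv/= => h1 h2 i; rewrite mxE.
  by case: unliftP => [j _|_] /=; [exact: h2|rewrite ltr_norml].
rewrite product_measure1E//; last exact: measurable_box.
rewrite exprS EFinM -IHn; congr (_ * _)%E.
have := @lebesgue_measure_itv R `]- r, r[; rewrite /= lte_fin gtrN// -EFinB => h.
by apply: (eq_trans h); congr (_%:E); lra.
Qed.

Let eball n (r : R) : set 'rV[R]_n := [set x | enorm x < r].

Lemma measurable_eball n r : measurable (@eball n r).
Proof.
rewrite (_ : eball r = (@enorm R n) @^-1` `]-oo, r[).
  by rewrite -[X in measurable X]setTI; exact: measurable_enorm.
by apply/seteqP; split => x /=; rewrite in_itv.
Qed.

Lemma lebesgue_eball n r : 0 < r -> (0 < lam n (eball r) < +oo)%E.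
Proof.
move=> r0; apply/andP; split; last first.
  apply: (@le_lt_trans _ _ (lam n (box r))).
    apply: le_measure; rewrite ?inE; [exact: measurable_eball|exact: measurable_box|].
    by move=> x /= xr i; apply: le_lt_trans xr; exact: coord_le_enorm.
  by rewrite lebesgue_box// ltry.
have d0 : 0 < r / n.+1%:R by rewrite divr_gt0.
apply: (@lt_le_trans _ _ (lam n (box (r / n.+1%:R)))).
  by rewrite lebesgue_box// lte_fin exprn_gt0// mulr_gt0.
apply: le_measure; rewrite ?inE; [exact: measurable_box|exact: measurable_eball|].
move=> x /= xr; rewrite /eball /= -(@ltr_pXn2r _ 2) ?nnegrE ?enorm_ge0 ?(ltW r0)//
  enorm_sqr.
apply: (@le_lt_trans _ _ (\sum_(i < n) (r / n.+1%:R) ^+ 2)).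
  apply: ler_sum => i _; rewrite -expr2 -real_normK ?num_real//.
  by rewrite ler_pXn2r ?nnegrE ?(ltW d0)// ltW.
rewrite sumr_const card_ord -[X in X < _]mulr_natr expr_div_n -mulrA gtr_pMr ?exprn_gt0//.
rewrite mulrC ltr_pdivrMr ?exprn_gt0// mul1r -natrX ltr_nat.
by rewrite (leq_trans (ltnSn n))// expnS expn1 leq_pmulr.
Qed.

(** [lebesgue_rV_additive_swap] with [g] the indicator of the unit ball, whose
    preimage under [L] is the ball of radius [e^-1].  With [L] the identity the
    same formula says that Lebesgue measure is symmetric, which removes the
    minus sign. *)
Lemma lebesgue_rV_similarity n (L K : 'rV[R]_n -> 'rV[R]_n) (e : R) :
  measurable_fun setT L -> (forall x y, L (x + y) = L x + L y) ->
  cancel K L -> 0 < e -> (forall x, enorm (L x) = e * enorm x) ->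
  exists c : R, [/\ 0 < c, e = 1 -> c = 1 &
    forall A, measurable A -> lam n (L @^-1` A) = (c%:E * lam n A)%E].
Proof.
move=> mL LD KL e0 Le.
have swap (L' K' : 'rV[R]_n -> 'rV[R]_n) A B : measurable_fun setT L' ->
    (forall x y, L' (x + y) = L' x + L' y) -> cancel K' L' ->
    measurable A -> measurable B ->
    (lam n (L' @^-1` A) * lam n B = lam n (-%R @^-1` A) * lam n (L' @^-1` B))%E.
  move=> mL' L'D K'L mA mB.
  have mpre (M : 'rV[R]_n -> 'rV[R]_n) C : measurable_fun setT M -> measurable C ->
    measurable (M @^-1` C) by move=> mM mC; rewrite -[X in measurable X]setTI; exact: mM.
  have := @lebesgue_rV_additive_swap _ _ L' K' (EFin \o \1_A) (EFin \o \1_B) mL' L'D K'L.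
  have mN : measurable_fun setT (fun x : 'rV[R]_n => - x) by exact: measurable_rVN.
  have E (M : 'rV[R]_n -> 'rV[R]_n) C : measurable_fun setT M -> measurable C ->
     (\int[lam n]_x (EFin \o \1_C) (M x) = lam n (M @^-1` C))%E.
    move=> mM mC; rewrite -[in RHS](setIT (_ @^-1` _)) -integral_indic//; exact: mpre.
  rewrite (E L' A)// (E L' B)// (E (fun x => - x) A)// (E (fun x => x) B)//.
  by apply; do ?[by move=> x; rewrite lee_fin]; apply/measurable_EFinP;
    exact: measurable_indic.
have /andP[b0 boo] := @lebesgue_eball n 1 ltr01.
have ei0 : 0 < e^-1 by rewrite invr_gt0.
have /andP[b'0 b'oo] := @lebesgue_eball n _ ei0.
have mB := @measurable_eball n 1.
have LB : L @^-1` (eball 1) = eball e^-1.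
  by apply/seteqP; split => x; rewrite /eball /= Le mulrC -ltr_pdivlMr// mul1r.
have bE : lam n (eball 1) = (fine (lam n (eball 1)))%:E.
  by rewrite fineK// ge0_fin_numE.
have b'E : lam n (eball e^-1) = (fine (lam n (eball e^-1)))%:E.
  by rewrite fineK// ge0_fin_numE.
set b := fine (lam n (eball 1)) in bE; set b' := fine (lam n (eball e^-1)) in b'E.
have bgt0 : 0 < b by rewrite -lte_fin -bE.
have b'gt0 : 0 < b' by rewrite -lte_fin -b'E.
have cancelb x y : (x * b%:E = y * b%:E -> x = y)%E.
  move=> h; rewrite -[x]mule1 -[y]mule1 (_ : 1%E = (b%:E * (b^-1)%:E)%E).
    by rewrite !muleA h.
  by rewrite -EFinM divff// gt_eqF.
have opp (A : set 'rV[R]_n) : measurable A -> lam n (-%R @^-1` A) = lam n A.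
  move=> mA; apply: cancelb.
  have := swap id id A (eball 1) (@measurable_id _ _ setT) (fun _ _ =>
    erefl) (fun _ => erefl) mA mB.
  by rewrite bE.
exists (b' / b); split; first by rewrite divr_gt0.
  by move=> e1; rewrite /b' /b e1 invr1 divff// gt_eqF.
move=> A mA; apply: cancelb; rewrite -{1}bE (swap L K)// opp// LB b'E.
by rewrite muleAC -EFinM divfK ?gt_eqF// muleC.
Qed.

End ball.

(** * Bounded measurable functions *)

Section bounded_functions.
Context {R : realType}.

Definition bounded_measurable d (T : measurableType d) (f : T -> R) :=
  measurable_fun setT f /\ exists M : R, forall x, `|f x| <= M.

Section closure.
Context d {T : measurableType d}.
Implicit Types f g : T -> R.

Lemma bm_cst c : bounded_measurable (fun _ : T => c).
Proof. by split => //; exists `|c|. Qed.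

Lemma bmD f g : bounded_measurable f -> bounded_measurable g ->
  bounded_measurable (fun x => f x + g x).
Proof.
move=> [mf [M fM]] [mg [M' gM]]; split; first exact: measurable_funD.
by exists (M + M') => x; rewrite (le_trans (ler_normD _ _))// lerD.
Qed.

Lemma bmN f : bounded_measurable f -> bounded_measurable (fun x => - f x).
Proof.
move=> [mf [M fM]]; split; first exact: measurableT_comp.
by exists M => x; rewrite normrN.
Qed.

Lemma bmB f g : bounded_measurable f -> bounded_measurable g ->
  bounded_measurable (fun x => f x - g x).
Proof. by move=> bf bg; apply: bmD => //; exact: bmN. Qed.

Lemma bmM f g : bounded_measurable f -> bounded_measurable g ->
  bounded_measurable (fun x => f x * g x).
Proof.
move=> [mf [M fM]] [mg [M' gM]]; split; first exact: measurable_funM.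
by exists (M * M') => x; rewrite normrM ler_pM.
Qed.

Lemma bmZ a f : bounded_measurable f -> bounded_measurable (fun x => a * f x).
Proof. by move=> bf; apply: bmM => //; exact: bm_cst. Qed.

Lemma bm_norm f : bounded_measurable f -> bounded_measurable (fun x => `|f x|).
Proof.
move=> [mf [M fM]]; split; first exact: measurableT_comp.
by exists M => x; rewrite normr_id.
Qed.

Lemma bm_if (b : T -> bool) f g : measurable_fun setT b -> bounded_measurable f ->
  bounded_measurable g ->
  bounded_measurable (fun x => if b x then f x else g x).
Proof.
move=> mb [mf [M fM]] [mg [M' gM]]; split; first exact: measurable_fun_ifT.
exists (M + M') => x.
have M0 : 0 <= M := le_trans (normr_ge0 _) (fM x).
have M'0 : 0 <= M' := le_trans (normr_ge0 _) (gM x).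
by case: ifPn => _; rewrite (le_trans (fM x), le_trans (gM x)) ?lerDl ?lerDr.
Qed.

End closure.

Lemma bm_comp d d' (T : measurableType d) (T' : measurableType d')
  (f : T -> R) (h : T' -> T) : bounded_measurable f -> measurable_fun setT h ->
    bounded_measurable (fun x => f (h x)).
Proof.
move=> [mf [M fM]] mh; split; first exact: measurableT_comp.
by exists M => x.
Qed.

Lemma bm_integrable d (T : measurableType d) (mu : {measure set T -> \bar R}) D f :
  (mu D < +oo)%E -> measurable D -> bounded_measurable f -> mu.-integrable D (EFin \o f).
Proof.
move=> moo mD [mf [M fM]]; apply: measurable_bounded_integrable => //.
  exact: measurable_funTS.
exists M; split; first exact: num_real.
by move=> y My x _ /=; rewrite (le_trans (fM x))// ltW.
Qed.

Section expectation.
Context d {T : measurableType d} (P : probability T R).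
Implicit Types f g : T -> R.

Lemma bm_int f : bounded_measurable f -> P.-integrable setT (EFin \o f).
Proof.
apply: bm_integrable => //.
exact: (le_lt_trans (probability_le1 P measurableT) (ltry 1)).
Qed.

Lemma bmE_le f g : bounded_measurable f -> bounded_measurable g ->
  (forall x, f x <= g x) ->
  \int[P]_x f x <= \int[P]_x g x.
Proof. by move=> bf bg fg; apply: le_Rintegral => //; exact: bm_int. Qed.

Lemma bmE_D f g : bounded_measurable f -> bounded_measurable g ->
  \int[P]_x (f x + g x) = \int[P]_x f x + \int[P]_x g x.
Proof. by move=> bf bg; apply: RintegralD => //; exact: bm_int. Qed.

Lemma bmE_B f g : bounded_measurable f -> bounded_measurable g ->
  \int[P]_x (f x - g x) = \int[P]_x f x - \int[P]_x g x.
Proof. by move=> bf bg; apply: RintegralB => //; exact: bm_int. Qed.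

Lemma bmE_Z a f : bounded_measurable f -> \int[P]_x (a * f x) = a * \int[P]_x f x.
Proof. by move=> bf; apply: RintegralZl => //; exact: bm_int. Qed.

Lemma bmE_N f : bounded_measurable f -> \int[P]_x (- f x) = - \int[P]_x f x.
Proof.
move=> bf; under eq_Rintegral do rewrite -mulN1r.
by rewrite bmE_Z// mulN1r.
Qed.

Lemma bmE_cst c : \int[P]_x c = c.
Proof.
rewrite Rintegral_cst//; have -> : (P : {measure set T ->
  \bar R}) setT = 1%E by exact: probability_setT.
by rewrite mulr1.
Qed.

Lemma bmE_norm f M : bounded_measurable f -> (forall x, `|f x| <= M) ->
  `|\int[P]_x f x| <= M.
Proof.
move=> bf fM; rewrite ler_norml -[X in X <= _ <= _]bmE_cst -[X in _ <= _ <= X]bmE_cst.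
by apply/andP; split; apply: bmE_le => //; try exact: bm_cst;
  move=> x; have := fM x; rewrite ler_norml => /andP[].
Qed.

Lemma bmE_fin f : bounded_measurable f -> (\int[P]_x (f x)%:E)%E = (\int[P]_x f x)%:E.
Proof. by move=> bf; rewrite /Rintegral fineK//; apply: integrable_fin_num => //;
  exact: bm_int. Qed.

End expectation.

Section fubini.
Context d1 d2 {T1 : measurableType d1} {T2 : measurableType d2}.
Variables (P1 : probability T1 R) (P2 : probability T2 R).

Lemma bm_pair1 (f : T1 * T2 -> R) x : bounded_measurable f ->
  bounded_measurable (fun y => f (x, y)).
Proof. by move=> bf; apply: (bm_comp (h := pair x) bf); exact: pair1_measurable. Qed.

Lemma bm_fubini (f : T1 * T2 -> R) : bounded_measurable f ->
  bounded_measurable (fun x => \int[P2]_y f (x, y)).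
Proof.
move=> bf; case: (bf) => mf [M fM]; split; last first.
  exists M => x; apply: bmE_norm => //; exact: bm_pair1.
pose g (p : T1 * T2) := (f p + M)%:E.
have g0 p : (0 <= g p)%E.
  by rewrite lee_fin; have := fM p; rewrite ler_norml => /andP[h _]; lra.
have mg : measurable_fun setT g by apply/measurable_EFinP; exact: measurable_funD.
have mG := @measurable_fun_fubini_tonelli_F _ _ _ _ _ P2 _ mg g0.
rewrite (_ : (fun _ => _) = (fun x => fine (fubini_F P2 g x) - M)).
  apply: measurable_funB => //; apply: measurableT_comp mG.
  exact: fine_measurable.
apply/funext => x; rewrite /fubini_F.
have bfx : bounded_measurable (fun y => f (x, y)) by exact: bm_pair1.
transitivity (\int[P2]_y (f (x, y) + M) - M); last by [].
by rewrite (bmE_D P2 bfx (bm_cst M)) bmE_cst addrK.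
Qed.

Lemma bmE_fubini (m : {measure set (T1 * T2) -> \bar R}) (f : T1 * T2 ->
  R) : bounded_measurable f ->
  (forall A, measurable A -> m A = (P1 \x P2)%E A) ->
  \int[m]_p f p = \int[P1]_x \int[P2]_y f (x, y).
Proof.
move=> bf mE; rewrite /Rintegral.
rewrite (eq_measure_integral (P1 \x P2)%E); last by move=> A mA _; exact: mE.
have i12 : ((P1 \x P2)%E).-integrable setT (EFin \o f).
  apply: bm_integrable => //; rewrite -setXTT [X in (X < _)%E](product_measure1E P1
    P2 measurableT measurableT).
  by rewrite lte_mul_pinfty// ?ge0_fin_numE// (le_lt_trans (probability_le1 _
    measurableT)) ?ltry.
rewrite -(integral12_prod_meas1 i12); congr fine; apply: eq_integral => x _.
by rewrite /fubini_F /= bmE_fin//; exact: bm_pair1.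
Qed.

End fubini.

Lemma Rintegral_pushforward d d' (T : measurableType d) (T' : measurableType d')
   (mu : {measure set T -> \bar R}) (h : T -> T') (f : T' -> R)
   (m : {measure set T' -> \bar R}) :
  (mu setT < +oo)%E -> bounded_measurable f -> measurable_fun setT h ->
  (forall A, measurable A -> m A = mu (h @^-1` A)) ->
  \int[m]_y f y = \int[mu]_x f (h x).
Proof.
move=> muoo bf mh mE; rewrite /Rintegral; congr fine.
rewrite -(preimage_setT h) -(integral_pushforward mh (f := EFin \o f))//.
- by apply: eq_measure_integral => A mA _; exact: mE.
- by apply/measurable_EFinP; case: bf.
- rewrite preimage_setT; apply: (bm_integrable (f := f \o h)) => //; exact: bm_comp.
Qed.

(** For nonnegative functions this is the integral against a scaled measure, the
    complement of [D] being [nu]-null; in general, subtract the two parts. *)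
Lemma Rintegral_mscale_restr d (T : measurableType d) (mu nu : {measure set T -> \bar R})
   (f : T -> R) (D : set T) (c : R) : 0 <= c -> measurable D -> bounded_measurable f ->
   (mu D < +oo)%E ->
   (forall A, measurable A -> nu A = c%:E * mu (A `&` D))%E ->
   \int[nu]_x f x = c * \int[mu]_(x in D) f x.
Proof.
move=> c0 mD bf muD nuE; rewrite /Rintegral.
have ge0 (g : T -> \bar R) : measurable_fun setT g -> (forall x, 0 <= g x)%E ->
   (\int[nu]_x g x = c%:E * \int[mu]_(x in D) g x)%E.
  move=> mg g0.
  rewrite (ge0_negligible_integral (measurableC mD))//;
    last by rewrite nuE ?setICl ?measure0 ?mule0//; exact: measurableC.
  rewrite setDE setTI setCK -[c]/((NngNum c0)%:num) -ge0_integral_mscale//;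
    last exact: measurable_funTS.
  by apply: eq_measure_integral => A mA AD; rewrite nuE// setIidl.
have mf : measurable_fun setT (EFin \o f) by apply/measurable_EFinP; case: bf.
have fin := bm_integrable muD mD bf.
rewrite integralE [in RHS]integralE !ge0//;
  [|exact: measurable_funeneg|exact: measurable_funepos].
have ip : (\int[mu]_(x in D) (EFin \o f)^\+ x)%E \is a fin_num.
  by apply: integrable_fin_num => //; exact: integrable_funepos.
have im : (\int[mu]_(x in D) (EFin \o f)^\- x)%E \is a fin_num.
  by apply: integrable_fin_num => //; exact: integrable_funeneg.
rewrite -muleBr//; last by rewrite fin_num_adde_defl// fin_numN.
by rewrite fineM// fin_numB ip im.
Qed.

Lemma Rintegral_bound d (T : measurableType d) (mu : {measure set T ->
  \bar R}) A (f : T -> R) M :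
  measurable A -> (mu A < +oo)%E -> bounded_measurable f -> (forall x, `|f x| <= M) ->
  `|\int[mu]_(x in A) f x| <= M * fine (mu A).
Proof.
move=> mA Aoo bf fM; rewrite -Rintegral_cst//.
have i1 : mu.-integrable A (EFin \o f) by exact: bm_integrable.
rewrite (le_trans (le_normr_Rintegral _ i1))//; apply: le_Rintegral => //.
- exact: (bm_integrable Aoo mA (bm_norm bf)).
- exact: (bm_integrable Aoo mA (bm_cst M)).
Qed.

Lemma Rintegral_sub_close d (T : measurableType d) (mu : {measure set T ->
  \bar R}) A C (f : T -> R) M a c :
  measurable A -> measurable C -> C `<=` A -> bounded_measurable f ->
    (forall x, `|f x| <= M) ->
  mu A = a%:E -> mu C = c%:E ->
  `|\int[mu]_(x in A) f x - \int[mu]_(x in C) f x| <= M * (a - c).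
Proof.
move=> mA mC CA bf fM Aa Cc.
have mD : measurable (A `\` C) by exact: measurableD.
have muD : mu (A `\` C) = (a - c)%:E.
  rewrite measureD//; last by rewrite [X in (X < _)%E]Aa ltry.
  by rewrite (setIidr CA) [X in (X - _)%E]Aa [X in (_ - X)%E]Cc.
have AE : A = C `|` (A `\` C) by rewrite setDUK.
have iA : mu.-integrable (C `|` (A `\` C)) (EFin \o f).
  by rewrite -AE; apply: bm_integrable => //; rewrite [X in (X < _)%E]Aa ltry.
rewrite [X in Rintegral mu X]AE Rintegral_setU//; last first.
  by apply/disj_setPS => x [Cx [_ /(_ Cx)]].
rewrite addrC addKr.
have := @Rintegral_bound _ _ mu (A `\` C) f M mD.
by rewrite muD /=; apply => //; rewrite ltry.
Qed.

End bounded_functions.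

(** * Jumps over rotated and dilated cones *)

Section rotations.
Context {R : realType} {n : nat}.
Local Notation V := 'rV[R]_n.

Lemma dotr_mx (x y : V) : dotr x y = (x *m y^T) ord0 ord0.
Proof. by rewrite mxE; apply: eq_bigr => i _; rewrite mxE. Qed.

Lemma dotr_mxact (M : 'M[R]_n) (x y : V) : M *m M^T = 1%:M ->
  dotr (mxact M x) (mxact M y) = dotr x y.
Proof.
move=> /mulmx1C MM; rewrite !dotr_mx /mxact trmx_mul trmxK mulmxA.
by rewrite -(mulmxA x) MM mulmx1.
Qed.

Lemma enorm_mxact (M : 'M[R]_n) (x : V) : M *m M^T = 1%:M ->
  enorm (mxact M x) = enorm x.
Proof. by move=> MM; rewrite /enorm dotr_mxact. Qed.

Lemma measurable_mxact (M : 'M[R]_n) : measurable_fun setT (mxact M).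
Proof.
apply/measurable_rVP => i; under eq_fun do rewrite mxE.
apply: measurable_sum => j; apply: measurable_funM => //.
exact: rV_coord_measurable.
Qed.

Definition similarity (e : R) (M : 'M[R]_n) (z : V) : V := e *: mxact M z.

Variables (e : R) (M : 'M[R]_n).
Hypotheses (e0 : 0 < e) (MM : M *m M^T = 1%:M).
Local Notation L := (similarity e M).

Lemma measurable_similarity : measurable_fun setT L.
Proof. by apply: measurable_rVZ => //; exact: measurable_mxact. Qed.

Lemma similarityD x y : L (x + y) = L x + L y.
Proof. by rewrite /similarity /mxact mulmxDl scalerDr. Qed.

Lemma similarityK : cancel (fun w => e^-1 *: (w *m M)) L.
Proof.
move=> w; rewrite /similarity /mxact -scalemxAl -mulmxA MM mulmx1 scalerA divff
  ?scale1r//.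
by rewrite gt_eqF.
Qed.

Lemma enorm_similarity x : enorm (L x) = e * enorm x.
Proof. by rewrite enormZ gtr0_norm// enorm_mxact. Qed.

(** The density is homogeneous of degree [- (n + 2 s)], so the constant is
    [e `^ (n + 2 s)] times the one for Lebesgue measure; the
    statement keeps its positivity and its value for isometries. *)
Lemma mu_frac_similarity (s : {posnum R}) :
  exists k : R, [/\ 0 < k, e = 1 -> k = 1 &
    forall A, measurable A -> mu_frac s (L @^-1` A) = (k%:E * mu_frac s A)%E].
Proof.
have [c [c0 c1 cE]] := lebesgue_rV_similarity measurable_similarity similarityD
  similarityK e0 enorm_similarity.
pose q := n%:R + 2 * s%:num.
have ep : 0 < e `^ q by exact: powR_gt0.
exists (e `^ q * c); split; first by rewrite mulr_gt0.
  by move=> e1; rewrite c1// mulr1 e1 powR1.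
move=> A mA; rewrite /mu_frac.
have dE z : mu_density s z = e `^ q * mu_density s (L z).
  rewrite /mu_density enorm_similarity powRM ?enorm_ge0 ?ltW//.
  by rewrite invfM mulrCA (mulrA (e `^ q)) divff ?mul1r// gt_eqF.
have d0 z : 0 <= mu_density s z by rewrite divr_ge0 ?Cns_ge0 ?powR_ge0.
have mL := measurable_similarity.
have mLA : measurable (L @^-1` A) by rewrite -[X in measurable X]setTI; exact: mL.
have md : measurable_fun setT (EFin \o @mu_density R n s).
  by apply/measurable_EFinP; exact: measurable_mu_density.
transitivity (\int[lebesgue_rV n]_(z in L @^-1` A) ((e `^ q)%:E * (EFin \o mu_density
  s \o L) z))%E.
  by apply: eq_integral => z _; rewrite dE EFinM.
have mdL : measurable_fun (L @^-1` A) (EFin \o mu_density s \o L).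
  by apply: measurable_funTS; exact: measurableT_comp.
have d0L z : (L @^-1` A) z -> (0 <= (EFin \o mu_density s \o L) z)%E.
  by rewrite lee_fin.
have ep0 : (0 <= (e `^ q)%:E)%E by rewrite lee_fin ltW.
rewrite (ge0_integralZl (lebesgue_rV n) mLA mdL d0L ep0).
rewrite EFinM -muleA; congr (_ * _)%E.
rewrite -ge0_integral_pushforward//; last 2 first.
- exact: measurable_funTS.
- by move=> z _; rewrite lee_fin.
have mdA : measurable_fun A (EFin \o @mu_density R n s) by exact: measurable_funTS.
have d0A z : A z -> (0 <= (EFin \o @mu_density R n s) z)%E by rewrite lee_fin.
rewrite -[c]/((NngNum (ltW c0))%:num).
rewrite -(ge0_integral_mscale (lebesgue_rV n) mA (NngNum (ltW c0)) mdA d0A).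
by apply: eq_measure_integral => B mB _; exact: cE.
Qed.

End rotations.

Section jumps.
Context {R : realType} {n : nat}.
Local Notation V := 'rV[R]_n.+2.
Variables (alpha : R) (s : {posnum R}).
Local Notation T1 := (cone alpha 1%:E +oo%E (@e1 R n)).
Hypothesis JT : @jump_law R n alpha s setT = 1%E.

Lemma jump_lawE (A : set V) :
  @jump_law R n alpha s A = ((fine (mu_frac s T1))^-1%:E * mu_frac s (A `&` T1))%E.
Proof. by []. Qed.

(** If the mass of the cone were zero or infinite, its finite part would be [0],
    hence so would be its inverse, and [jump_law] would vanish.  So
    [JT] alone bounds the mass of the cone on both sides. *)
Lemma mu_cone1 : exists2 m : R, 0 < m & mu_frac s T1 = m%:E.
Proof.
have := JT; rewrite jump_lawE setTI.
have : (0 <= mu_frac s T1)%E by exact: measure_ge0.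
case: (mu_frac s T1) => [m| |] //=.
- rewrite lee_fin => m0; rewrite -EFinM => -[h]; exists m => //.
  rewrite lt_def m0 andbT; apply/eqP => m00; move: h.
  by rewrite m00 mulr0 => /esym/eqP; rewrite oner_eq0.
- by move=> _; rewrite invr0 mul0e => -[/esym/eqP]; rewrite oner_eq0.
Qed.

HB.instance Definition _ := Measure_isProbability.Build _ _ _ (@jump_law R n alpha s) JT.
Definition jump_prob : probability V R := @jump_law R n alpha s.

Lemma jump_probE (A : set V) :
  jump_prob A = ((fine (mu_frac s T1))^-1%:E * mu_frac s (A `&` T1))%E.
Proof. by []. Qed.


Lemma angle_similarity (e : R) (M : 'M[R]_n.+2) (y z : V) :
  0 < e -> M *m M^T = 1%:M -> mxact M e1 = y ->
  angle y (similarity e M z) = angle e1 z.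
Proof.
move=> e0 MM <-; rewrite /angle dotrZr dotr_mxact// enorm_similarity// enorm_mxact//.
by rewrite mulrCA -mulf_div divff ?mul1r// gt_eqF.
Qed.

Lemma cone_similarity (e a : R) (M : 'M[R]_n.+2) (y : V) :
  0 < e -> M *m M^T = 1%:M -> mxact M e1 = y ->
  similarity e M @^-1` cone alpha (e * a)%:E +oo y = cone alpha a%:E +oo e1.
Proof.
move=> e0 MM My; apply/seteqP; split => z;
  rewrite /cone /= angle_similarity// enorm_similarity// !ltry !andbT !lte_fin;
  by rewrite ltr_pM2l.
Qed.

(** The factor by which the similarity scales [mu_frac] cancels in the
    normalisation. *)
Lemma jump_similarity (e : R) (M : 'M[R]_n.+2) (y : V) :
  0 < e -> M *m M^T = 1%:M -> mxact M e1 = y ->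
  exists2 m : R, 0 < m & mu_frac s (cone alpha e%:E +oo y) = m%:E /\
   forall A, measurable A ->
    jump_prob (similarity e M @^-1` A) = (m^-1%:E * mu_frac s (A `&` cone alpha e%:E
      +oo y))%E.
Proof.
move=> e0 MM My; have [m m0 mE] := mu_cone1.
have [k [k0 _ kE]] := mu_frac_similarity e0 MM s.
have mc := @measurable_cone R n.+2 alpha e%:E +oo%E y.
have cE : similarity e M @^-1` cone alpha e%:E +oo y = T1.
  by rewrite -(cone_similarity 1 e0 MM My) mulr1.
have := kE _ mc; rewrite cE mE.
have : (0 <= mu_frac s (cone alpha e%:E +oo y))%E by exact: measure_ge0.
move: (kE); case E : (mu_frac s (cone alpha e%:E +oo y)) => [m'| |] //; last first.
  by move=> _ _; rewrite gt0_muley.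
move=> _ m'0; rewrite -EFinM => -[mkm'].
have m'gt0 : 0 < m' by rewrite -(pmulr_rgt0 _ k0) -mkm'.
exists m' => //; split => // A mA.
rewrite jump_probE mE /=.
rewrite -cE -preimage_setI kE; last exact: measurableI.
rewrite muleA -EFinM mkm' invfM mulrAC mulVf ?mul1r// gt_eqF//.
Qed.

Lemma mu_avgE (e : R) (M : 'M[R]_n.+2) (y : V) (f : V -> R) :
  0 < e -> M *m M^T = 1%:M -> mxact M e1 = y -> bounded_measurable f ->
  mu_avg s (cone alpha e%:E +oo y) f = \int[jump_prob]_z f (similarity e M z).
Proof.
move=> e0 MM My bf; have [m m0 [mE JE]] := jump_similarity e0 MM My.
have mL := measurable_similarity e M.
rewrite /mu_avg mE /=.
have mc := @measurable_cone R n.+2 alpha e%:E +oo%E y.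
have i0 : 0 <= m^-1 by rewrite invr_ge0 ltW.
have muoo : (mu_frac s (cone alpha e%:E +oo y) < +oo)%E by rewrite mE ltry.
have nuE A : measurable A -> mimage jump_prob mL A =
    (m^-1%:E * mu_frac s (A `&` cone alpha e%:E +oo y))%E by exact: JE.
have E := Rintegral_mscale_restr (mu := mu_frac s) (nu := mimage jump_prob mL)
  i0 mc bf muoo nuE.
transitivity (\int[mimage jump_prob mL]_z f z); first exact/esym/E.
apply: Rintegral_pushforward => //.
exact: (le_lt_trans (probability_le1 jump_prob measurableT) (ltry 1)).
Qed.

Lemma mu_cone_sphere (e : R) (M : 'M[R]_n.+2) (y : V) :
  0 < e -> M *m M^T = 1%:M -> mxact M e1 = y ->
  mu_frac s (cone alpha e%:E +oo y) = mu_frac s (cone alpha e%:E +oo (@e1 R n)).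
Proof.
move=> e0 MM My; have [k [_ k1 kE]] := mu_frac_similarity ltr01 MM s.
have := kE _ (@measurable_cone R n.+2 alpha e%:E +oo%E y).
have := cone_similarity e ltr01 MM My; rewrite mul1r => ->.
by rewrite (k1 erefl) mul1e => ->.
Qed.

(** The part of the reference cone beyond radius [max r 1] is a dilation of the
    whole cone, so its mass is positive. *)
Lemma jump_far (r : R) : exists2 t : R, 0 < t &
  (t%:E <= jump_prob [set z | (r < enorm z)%R])%E.
Proof.
pose r1 := Num.max r 1.
have r10 : 0 < r1 by rewrite lt_max ltr01 orbT.
have I1 : (1%:M : 'M[R]_n.+2) *m 1%:M^T = 1%:M by rewrite trmx1 mulmx1.
have I2 : mxact 1%:M e1 = @e1 R n by rewrite /mxact trmx1 mulmx1.
have [m m0 [mE _]] := jump_similarity r10 I1 I2.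
have [m1 m10 m1E] := mu_cone1.
exists (m1^-1 * m); first by rewrite mulr_gt0// invr_gt0.
rewrite jump_probE m1E /= EFinM -mE.
rewrite lee_pmul2l// ?lte_fin ?invr_gt0//.
apply: le_measure; rewrite ?inE.
- exact: measurable_cone.
- apply: measurableI; last exact: measurable_cone.
  rewrite (_ : mkset _ = (@enorm R n.+2) @^-1` `]r, +oo[).
    by rewrite -[X in measurable X]setTI; exact: measurable_enorm.
  by apply/seteqP; split => x /=; rewrite in_itv/= andbT.
- move=> z [az /andP[]]; rewrite lte_fin gt_max => /andP[rz z1] _.
  by split => //; split => //; rewrite lte_fin z1 ltry.
Qed.

End jumps.

(** * Measurability of the rotation in its target *)

Section rotation_formula.
Context {R : realType}.

(** The matrix determinant lemma, by comparing two block triangular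
    factorisations of the same matrix. *)
Lemma det_rank1 m (u : 'cV[R]_m) (v : 'rV[R]_m) :
  \det (1%:M + u *m v) = 1 + (v *m u) ord0 ord0.
Proof.
have E : block_mx 1%:M 0 v 1%:M *m block_mx (1%:M + u *m v) u 0 1%:M
     = block_mx 1%:M u 0 (1%:M + v *m u) *m block_mx 1%:M 0 v (1%:M : 'M[R]_1).
  rewrite !mulmx_block !mul1mx !mulmx1 !mul0mx ?mulmx0 ?addr0 ?add0r.
  by rewrite mulmxDr mulmxDl mulmx1 mul1mx mulmxA (addrC (v *m u)).
have := congr1 determinant E; rewrite !det_mulmx !det_lblock !det_ublock !det1.
by rewrite !mul1r !mulr1 => ->; rewrite det_mx11 !mxE eqxx.
Qed.

Context {n : nat}.
Local Notation V := 'rV[R]_n.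
Implicit Types x y v w z : V.

Definition householder v : 'M[R]_n := 1%:M - (2 / dotr v v) *: (v^T *m v).

Lemma mul_householder x v : x *m householder v = x - (2 * dotr x v / dotr v v) *: v.
Proof.
rewrite /householder mulmxBr mulmx1 -scalemxAr mulmxA [x *m _]mx11_scalar -dotr_mx.
by rewrite mul_scalar_mx scalerA mulrAC.
Qed.

Lemma eq_mulmx m (A B : 'M[R]_(n, m)) : (forall x, x *m A = x *m B) -> A = B.
Proof. by move=> h; apply/row_matrixP => i; rewrite !rowE h. Qed.

Lemma householderK v : dotr v v != 0 -> householder v *m householder v = 1%:M.
Proof.
move=> v0; apply: eq_mulmx => x; rewrite mulmxA !mul_householder mulmx1.
rewrite dotrBl dotrZl -addrA -opprD -scalerDl [X in X *: v](_ : _ = 0) ?scale0r ?subr0//.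
by field.
Qed.

Lemma householder_tr v : (householder v)^T = householder v.
Proof. by rewrite /householder linearB/= linearZ/= trmx1 trmx_mul trmxK. Qed.

Lemma det_householder v : dotr v v != 0 -> \det (householder v) = -1.
Proof.
move=> v0; rewrite /householder -scaleNr scalemxAl det_rank1 -scalemxAr mxE -dotr_mx.
by field.
Qed.

(** The product of reflections on the right sends [x] to [- x] and then to [y], has
    determinant one, and fixes the vectors orthogonal to [x] and [y].  Its
    inverse composed with [M] therefore fixes a hyperplane pointwise; as it is
    orthogonal it multiplies the normal [f] of the hyperplane by a scalar [l],
    which is its determinant, so [l = 1]. *)
Lemma rotation_formula (M : 'M[R]_n) x y :
  enorm x = 1 -> enorm y = 1 -> is_SO M -> mxact M x = y ->
  (y = x -> M = 1%:M) -> y <> - x ->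
  (forall z, dotr z x = 0 -> dotr z y = 0 -> mxact M z = z) ->
  M^T = householder x *m householder (x + y).
Proof.
move=> x1 y1 [MM detM] Mx Meq yNx Mfix.
have xx : dotr x x = 1 by rewrite -enorm_sqr x1 expr1n.
have yy : dotr y y = 1 by rewrite -enorm_sqr y1 expr1n.
pose c := dotr x y.
have yx : dotr y x = c by rewrite dotrC.
have ww : dotr (x + y) (x + y) = 2 * (1 + c).
  by rewrite !(dotrDl, dotrDr) xx yy yx /c; ring.
have w0 : dotr (x + y) (x + y) != 0.
  apply/eqP => /dotr_eq0 h; apply: yNx; apply/eqP; rewrite -subr_eq0 opprK addrC.
  exact/eqP.
have x0 : dotr x x != 0 by rewrite xx oner_neq0.
have c1 : 1 + c != 0 by move: w0; rewrite ww mulf_eq0 pnatr_eq0.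
have [yxE|/eqP yxN] := eqVneq y x.
  rewrite Meq// trmx1 yxE -(householderK x0); congr (_ *m _).
  have -> : x + x = 2 *: x by rewrite scaler_nat mulr2n.
  apply: eq_mulmx => z; rewrite !mul_householder !(dotrZl, dotrZr) xx scalerA.
  by congr (_ - _ *: _); field.
pose B := M^T *m householder (x + y) *m householder x.
suff B1 : B = 1%:M.
  rewrite -[M^T]mulmx1 -(householderK w0) mulmxA -[X in X *m _]mulmx1 -(householderK x0).
  by rewrite (mulmxA _ (householder x)) -/B B1 mul1mx.
have detB : \det B = 1.
  by rewrite !det_mulmx det_tr detM !det_householder// mul1r mulrNN mulr1.
have BB : B *m B^T = 1%:M.
  rewrite /B !trmx_mul !householder_tr trmxK.
  rewrite -!mulmxA (mulmxA (householder x)) householderK// mul1mx.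
  by rewrite (mulmxA (householder (x + y))) householderK// mul1mx; exact: mulmx1C.
have xB : x *m B = x.
  rewrite /B !mulmxA -/(mxact M x) Mx (mul_householder y) ww dotrDr yy yx.
  rewrite [_ / _](_ : _ = 1); last by field; rewrite c1.
  rewrite scale1r opprD addrCA subrr addr0 mul_householder dotrNl xx divr1 mulrN1.
  by rewrite scaleNr opprK scaler_nat mulr2n addKr.
have zB z : dotr z x = 0 -> dotr z y = 0 -> z *m B = z.
  move=> zx zy; rewrite /B !mulmxA -/(mxact M z) Mfix// (mul_householder z).
  by rewrite dotrDr zx zy addr0 mulr0 mul0r scale0r subr0 (mul_householder z) zx
    mulr0 mul0r scale0r subr0.
(* A normal, in the plane of [x] and [y], to the hyperplane that [B] fixes. *)
clearbody B; pose f := y - c *: x.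
have fx : dotr f x = 0 by rewrite /f dotrBl dotrZl yx xx mulr1 subrr.
have f0 : dotr f f != 0.
  apply/eqP => /dotr_eq0 /eqP; rewrite subr_eq0 => /eqP yE.
  have : c ^+ 2 = 1 by rewrite -yy yE dotrZl dotrZr xx mulr1 expr2.
  move=> /eqP; rewrite sqrf_eq1 => /orP[] /eqP cE.
    by apply: yxN; rewrite yE cE scale1r.
  by apply: yNx; rewrite yE cE scaleN1r.
have Bdot u v : dotr (u *m B) (v *m B) = dotr u v.
  by rewrite !dotr_mx trmx_mul mulmxA -(mulmxA u) BB mulmx1.
have perpB z : dotr z f = 0 -> z *m B = z.
  move=> zf; have -> : z = (z - dotr z x *: x) + dotr z x *: x by rewrite subrK.
  rewrite mulmxDl -scalemxAl xB zB//.
    by rewrite dotrBl dotrZl xx mulr1 subrr.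
  have -> : y = f + c *: x by rewrite subrK.
  rewrite dotrDr dotrBl zf dotrZl (dotrC x f) fx mulr0 subr0 dotrZr add0r.
  by rewrite dotrBl dotrZl xx mulr1 subrr mulr0.
pose l := dotr (f *m B) f / dotr f f.
have fB : f *m B = l *: f.
  apply/eqP; rewrite -subr_eq0; apply/eqP/dotr_eq0.
  set q := _ - _.
  have qf : dotr q f = 0 by rewrite dotrBl dotrZl divfK// subrr.
  rewrite {2}/q dotrBr dotrZr qf mulr0 subr0 -(perpB q qf) Bdot.
  by [].
have BE : B = 1%:M + ((l - 1) / dotr f f) *: (f^T *m f).
  apply: eq_mulmx => z; rewrite mulmxDr mulmx1 -scalemxAr mulmxA [z *m
    f^T]mx11_scalar -dotr_mx.
  rewrite mul_scalar_mx scalerA.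
  pose a := dotr z f / dotr f f.
  have zE : z = (z - a *: f) + a *: f by rewrite subrK.
  rewrite {1}zE mulmxDl -scalemxAl fB perpB; last first.
    by rewrite dotrBl dotrZl divfK// subrr.
  rewrite -addrA; congr (_ + _); rewrite scalerA -scaleNr -scalerDl; congr (_ *: _).
  by rewrite /a; field.
have : \det B = l.
  rewrite BE scalemxAl det_rank1 -scalemxAr mxE -dotr_mx divfK//.
  by rewrite addrC subrK.
by rewrite detB BE => <-; rewrite subrr mul0r scale0r addr0.
Qed.

End rotation_formula.

Section rotation_measurable.
Context {R : realType} {n : nat}.
Local Notation V := 'rV[R]_n.+2.

Lemma e1_sphere : usphere (@e1 R n).
Proof.
rewrite /usphere /= /enorm /dotr (bigD1 ord0)//= big1 ?addr0 => [|i i0].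
  by rewrite /e1 mxE eqxx mulr1 sqrtr1.
by rewrite /e1 mxE eqxx (negbTE i0) mul0r.
Qed.

Lemma measurable_dotr2 n' d (T : measurableType d) (f g : T -> 'rV[R]_n') :
  measurable_fun setT f -> measurable_fun setT g ->
  measurable_fun setT (fun t => dotr (f t) (g t)).
Proof.
move=> /measurable_rVP mf /measurable_rVP mg.
by apply: measurable_sum => i; apply: measurable_funM.
Qed.

Lemma measurable_inv_ge0 d (T : measurableType d) (f : T -> R) :
  (forall t, 0 <= f t) ->
  measurable_fun setT f -> measurable_fun setT (fun x => (f x)^-1).
Proof.
move=> f0 mf; rewrite [X in measurable_fun _ X](_ : _ = fun x => f x `^ (-1)).
  exact: (measurableT_comp (measurable_powR _)).
by apply/funext => x; rewrite powR_inv1.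
Qed.

(** [Rot (- e1) e1] is an arbitrary element of SO that does not fit the formula
    valid elsewhere, but a single point is a Borel set. *)
Lemma measurable_rotation (Rot : V -> V -> 'M[R]_n.+2) d (T : measurableType d)
    (f g : T -> V) : rotation_family Rot ->
  measurable_fun setT f -> measurable_fun setT g -> (forall t, usphere (f t)) ->
  measurable_fun setT (fun t => mxact (Rot (f t) e1) (g t)).
Proof.
move=> RF mf mg fS; pose z1 t := g t - (2 * dotr (g t) e1) *: e1.
pose w t := e1 + f t.
pose b t := enorm (w t) == 0.
have mw : measurable_fun setT w by apply: measurable_rVD.
have mb : measurable_fun setT b.
  apply: (measurable_fun_bool true) => //=.
  rewrite setTI (_ : _ @^-1` _ = (fun t => enorm (w t)) @^-1` [set 0]).
    rewrite -[X in measurable X]setTI;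
      apply: (measurableT_comp measurable_enorm mw) => //.
  by apply/seteqP; split => t /=; rewrite /b => /eqP.
rewrite (_ : (fun _ => _) = fun t => if b t then mxact (Rot (- e1) e1) (g t)
   else z1 t - (2 * dotr (z1 t) (w t) / dotr (w t) (w t)) *: w t).
  have mz1 : measurable_fun setT z1.
    apply: measurable_rVD => //; apply: measurable_rVN; apply: measurable_rVZ => //.
    by apply: measurable_funM => //; exact: measurable_dotr2.
  apply: measurable_fun_ifT => //.
    exact: (measurableT_comp (measurable_mxact _)).
  apply: measurable_rVD => //; apply: measurable_rVN; apply: measurable_rVZ => //.
  apply: measurable_funM; last first.
    by apply: measurable_inv_ge0 => [t|]; [exact: dotr_ge0|exact: measurable_dotr2].
  by apply: measurable_funM => //; exact: measurable_dotr2.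
apply/funext => t; case: ifPn => [/eqP/enorm_eq0|] wt.
  by congr (mxact (Rot _ _) _); apply/eqP; rewrite -subr_eq0 opprK addrC -/(w t) wt.
have [SO Rf Req Rfix] := RF _ _ (fS t) e1_sphere.
have fN : f t <> - e1.
  by move=> fE; move: wt; rewrite /b /w fE subrr enorm0 eqxx.
rewrite /mxact (rotation_formula e1_sphere (fS t) SO Rf Req fN (Rfix fN)).
have e11 : dotr (@e1 R n) e1 = 1 by rewrite -enorm_sqr (e1_sphere : enorm _ = 1) expr1n.
by rewrite mulmxA !mul_householder e11 divr1.
Qed.

End rotation_measurable.

(** * Dependence of cone averages on the axis *)

Section directions.
Context {R : realType} {n : nat}.
Implicit Types x y z : 'rV[R]_n.

Lemma enormD x y : enorm (x + y) <= enorm x + enorm y.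
Proof.
rewrite -(@ler_pXn2r _ 2) ?nnegrE ?addr_ge0 ?enorm_ge0// sqrrD !enorm_sqr.
rewrite !(dotrDl, dotrDr) (dotrC y x) addrA lerD2r -addrA lerD2l -mulr2n.
by rewrite lerMn2r/= (le_trans (ler_norm _))// cauchy_schwarz.
Qed.

Lemma enormN x : enorm (- x) = enorm x.
Proof. by rewrite -scaleN1r enormZ normrN1 mul1r. Qed.

Lemma enorm_le_coord x b : 0 <= b -> (forall i, `|x ord0 i| <= b) ->
  enorm x <= n%:R * b.
Proof.
move=> b0 xb; rewrite -(@ler_pXn2r _ 2) ?nnegrE ?mulr_ge0 ?enorm_ge0// enorm_sqr.
apply: (@le_trans _ _ (\sum_(i < n) b ^+ 2)).
  apply: ler_sum => i _; rewrite -expr2 -real_normK ?num_real//.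
  by rewrite ler_pXn2r ?nnegrE.
rewrite sumr_const card_ord -[X in X <= _]mulr_natl exprMn ler_wpM2r ?sqr_ge0//.
by rewrite -natrX ler_nat; case: (n) => // k; rewrite expnS expn1 leq_pmulr.
Qed.

Lemma enorm_direction x : 0 < enorm x -> enorm (direction x) = 1.
Proof.
by move=> x0; rewrite /direction enormZ gtr0_norm ?invr_gt0// mulVf// gt_eqF.
Qed.

(** The radial projection moves [x] by the distance from [enorm x] to
    [1 = enorm y], which is at most the distance from [x] to [y]. *)
Lemma direction_dist x y : enorm y = 1 -> 0 < enorm x ->
  enorm (direction x - y) <= 2 * enorm (x - y).
Proof.
move=> y1 x0; have -> : direction x - y = (direction x - x) + (x - y) by rewrite
  addrA subrK.
rewrite mulr_natl mulr2n (le_trans (enormD _ _))// lerD2r.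
have -> : direction x - x = ((enorm x)^-1 - 1) *: x by rewrite scalerBl scale1r.
rewrite enormZ -[X in _ * X]gtr0_norm// -normrM mulrBl mulVf ?gt_eqF// mul1r ler_norml.
have := enormD (x - y) y; have := enormD x (y - x).
by rewrite addrCA subrr addr0 subrK y1 -(opprB x y) enormN; lra.
Qed.

(** This form of the cone condition shows that it is open in [y]. *)
Lemma angle_ltE (alpha : R) y z : 0 < alpha <= pi -> enorm y = 1 -> 0 < enorm z ->
  (angle y z < alpha) = (cos alpha * enorm z < dotr y z).
Proof.
move=> /andP[a0 api] y1 z0; rewrite /angle y1 mul1r -ltr_pdivlMr//.
have t1 : -1 <= dotr y z / enorm z <= 1.
  rewrite -ler_norml normrM normfV (gtr0_norm z0) ler_pdivrMr// mul1r.
  by rewrite (le_trans (cauchy_schwarz _ _))// y1 mul1r.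
rewrite -[in RHS](acosK t1) ltr_cos// in_itv/= ?acos_ge0 ?acos_lepi// ltW//=.
Qed.

Lemma coord_le_norm x i : `|x ord0 i| <= `|x|.
Proof.
rewrite [leRHS]/Num.norm /= mx_normrE.
exact: (le_bigmax _ (fun ij => `|x ij.1 ij.2|) (ord0, i)).
Qed.

End directions.

Section dense_directions.
Context {R : realType} {n : nat}.
Local Notation V := 'rV[R]_n.+2.

(** An enumeration of the normalised rational vectors, with [e1] as default value,
    which is dense in the sphere. *)
Definition rat_direction (j : nat) : V :=
  if (unpickle j : option 'rV[rat]_n.+2) is Some q then
    let v : V := \row_i ratr (q ord0 i) in
    if 0 < enorm v then direction v else e1
  else e1.

Lemma rat_direction_sphere j : usphere (rat_direction j).
Proof.
rewrite /rat_direction; case: (unpickle j : option 'rV[rat]_n.+2) => [q|] /=;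
  last exact: e1_sphere.
by case: ifPn => [|_]; [exact: enorm_direction|exact: e1_sphere].
Qed.

Lemma rat_direction_dense (y : V) (d : R) : usphere y -> 0 < d ->
  exists j, enorm (rat_direction j - y) < d.
Proof.
move=> y1 d0; pose d' := Num.min d 1 / 4.
have d'0 : 0 < d' by rewrite divr_gt0// lt_min d0 ltr01.
pose b := d' / n.+2%:R.
have b0 : 0 < b by rewrite divr_gt0.
have q_ i : exists q : rat, `|ratr q - y ord0 i| < b.
  have /rat_in_itvoo[q] : y ord0 i - b < y ord0 i + b.
    by rewrite ltrD2l (lt_trans _ b0)// oppr_lt0.
  by rewrite in_itv/= => /andP[q1 q2]; exists q; rewrite ltr_distl q1 q2.
have [q qP] := choice q_.
pose v : V := \row_i ratr (q i).
have vy : enorm (v - y) <= d'.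
  rewrite (_ : d' = n.+2%:R * b); last by rewrite /b mulrC divfK// pnatr_eq0.
  by apply: enorm_le_coord => [|i]; [exact: ltW|rewrite !mxE ltW].
have v0 : 0 < enorm v.
  have := enormD (y - v) v; rewrite subrK (y1 : enorm y = 1) -opprB enormN.
  have : d' <= 1 / 4 by rewrite /d' ler_pM2r ?invr_gt0// ge_min lexx orbT.
  by move: vy; lra.
exists (pickle (\row_i q i : 'rV[rat]_n.+2)).
rewrite /rat_direction pickleK.
rewrite (_ : \row_i _ = v); last by apply/rowP => i; rewrite !mxE.
rewrite v0 (le_lt_trans (direction_dist y1 v0))//.
have : d' <= d / 4 by rewrite /d' ler_pM2r ?invr_gt0// ge_min lexx.
by move: vy; lra.
Qed.

End dense_directions.

Lemma close_trans (R : realType) (a b c e d : R) :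
  `|a - c| <= e -> `|b - c| <= e -> 2 * e < d -> `|b - a| < d.
Proof.
rewrite !ler_norml ltr_norml => /andP[h1 h2] /andP[h3 h4] ed.
by apply/andP; split; lra.
Qed.

Section cone_average.
Context {R : realType} {n : nat}.
Local Notation V := 'rV[R]_n.+2.
Variables (alpha : R) (s : {posnum R}).
Hypothesis JT : @jump_law R n alpha s setT = 1%E.
Hypothesis alpha_itv : 0 < alpha <= pi.
Variable Rot : V -> V -> 'M[R]_n.+2.
Hypothesis RotF : rotation_family Rot.
Variable eps : R.
Hypothesis eps0 : 0 < eps.
Local Notation T := (cone alpha eps%:E +oo%E).

Lemma cone_open_at (y : V) (v : nat -> V) z : usphere y -> (forall k, usphere (v k)) ->
  (forall k, enorm (v k - y) < k.+1%:R^-1) -> T y z ->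
  exists k0 : nat, forall k, (k0 <= k)%N -> T (v k) z.
Proof.
move=> y1 v1 vy [+ ez].
have z0 : 0 < enorm z.
  by move: ez => /andP[+ _]; rewrite lte_fin; exact: lt_trans.
rewrite /cone/= angle_ltE// => h.
pose g := (dotr y z - cos alpha * enorm z) / enorm z.
have g0 : 0 < g by rewrite divr_gt0// subr_gt0.
have [k0 _ k0P] := near_infty_natSinv_lt (PosNum g0).
exists k0 => k kk; split => //; rewrite angle_ltE//; last exact: v1.
have : `|dotr (v k - y) z| < g * enorm z.
  rewrite (le_lt_trans (cauchy_schwarz _ _))// ltr_pM2r//.
  by rewrite (lt_trans (vy k))//; exact: k0P.
rewrite dotrBl /g divfK ?gt_eqF// ltr_norml => /andP[]; lra.
Qed.

(** Let [v k] be rational directions tending to [y].  As cones are open in their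
    axis, the set [C k] of the points of the cone of axis [y] that lie in the
    cones of axes [v j] for all [j >= k] increases to that cone.  All these cones
    have the same mass by rotation invariance, so the two integrals differ from
    the integral over [C k] by at most [M] times the same small mass. *)
Lemma cone_avg_approx (f : V -> R) (y : V) (eta : R) : bounded_measurable f ->
  usphere y -> 0 < eta ->
  exists j, `|mu_avg s (T (rat_direction j)) f - mu_avg s (T y) f| < eta.
Proof.
move=> bf y1 eta0; have [M fM] := bf.2.
have M0 : 0 <= M := le_trans (normr_ge0 _) (fM 0).
have Rot_orthogonal x : usphere x ->
  Rot x e1 *m (Rot x e1)^T = 1%:M /\ mxact (Rot x e1) e1 = x.
  by move=> xS; have [[]] := RotF xS e1_sphere.
have [m m0 [mE _]] := jump_similarity JT eps0 (Rot_orthogonal _ y1).1 (Rot_orthogonal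
  _ y1).2.
have mS (x : V) : usphere x -> mu_frac s (T x) = m%:E.
  move=> xS; rewrite -mE (mu_cone_sphere _ _ eps0 (Rot_orthogonal _ xS).1
    (Rot_orthogonal _ xS).2).
  by rewrite (mu_cone_sphere _ _ eps0 (Rot_orthogonal _ y1).1 (Rot_orthogonal _ y1).2).
have mT (x : V) : measurable (T x) by exact: measurable_cone.
have jE k : exists j, enorm (@rat_direction R n j - y) < k.+1%:R^-1.
  by apply: rat_direction_dense => //; rewrite invr_gt0.
have [jj jjP] := choice jE.
pose v k : V := rat_direction (jj k).
have v1 k : usphere (v k) by exact: rat_direction_sphere.
pose C k := T y `&` \bigcap_(j in [set j | (k <= j)%N]) T (v j).
have mC k : measurable (C k).
  by apply: measurableI => //; apply: bigcap_measurableType => j _; exact: mT.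
have ndC : nondecreasing_seq C.
  move=> k l kl; apply/subsetPset => z [Tz h]; split => // j /= lj; apply: h => /=.
  exact: leq_trans lj.
have CT : \bigcup_k C k = T y.
  apply/seteqP; split => [z [k _ []]//|z Tz].
  have [k0 k0P] := cone_open_at y1 v1 jjP Tz.
  by exists k0 => //; split => // j /= /k0P.
have mUC : measurable (\bigcup_k C k) by rewrite CT.
have cvgC : (mu_frac s \o C) k @[k --> \oo] --> m%:E.
  by rewrite -mE -CT; exact: nondecreasing_cvg_mu.
have Cfin k : mu_frac s (C k) = (fine (mu_frac s (C k)))%:E.
  rewrite fineK// ge0_fin_numE//; apply: (@le_lt_trans _ _ (mu_frac s (T y)));
    last by rewrite mE ltry.
  by apply: le_measure; rewrite ?inE// => z [].
(* Makes [2 * M * del] smaller than [m * eta]. *)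
pose del := m * eta / (2 * M + 1).
have M1 : 0 < 2 * M + 1 by rewrite ltr_pwDr// mulr_ge0.
have del0 : 0 < del by rewrite divr_gt0 ?mulr_gt0.
have [k kP] : exists k, m - fine (mu_frac s (C k)) < del.
  move/fine_cvgP : cvgC => [_] /cvgrPdist_lt /(_ _ del0) [k _ /(_ k (leqnn _))] /= h.
  by exists k; rewrite (le_lt_trans (ler_norm _) h).
exists (jj k); rewrite -/(v k) /mu_avg !mS//= -mulrBr normrM gtr0_norm ?invr_gt0//.
rewrite mulrC ltr_pdivrMr// mulrC.
have b1 := @Rintegral_sub_close R _ _ (mu_frac s) (T y) (C k) f M m _ (mT _) (mC k) _
  bf fM (mS _ y1) (Cfin k).
have b2 := @Rintegral_sub_close R _ _ (mu_frac s) (T (v k)) (C k) f M m _ (mT _) (mC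
  k) _ bf fM (mS _ (v1 k)) (Cfin k).
have {}b1 := b1 (@subIsetl _ _ _).
have {}b2 := b2 (fun z h => h.2 k (leqnn k)).
apply: (close_trans b1 b2).
apply: (@le_lt_trans _ _ (2 * (M * del))).
  by rewrite ler_pM2l// ler_wpM2l// ltW.
have -> : 2 * (M * del) = m * eta * (2 * M / (2 * M + 1)) by rewrite /del; ring.
by rewrite gtr_pMr ?mulr_gt0// ltr_pdivrMr// mul1r ltrDl.
Qed.

End cone_average.

(** * The dynamic programming equation *)

Section measurable_tools.
Context {R : realType} d {T : measurableType d}.

Lemma measurable_mem (D : set T) : measurable D -> measurable_fun setT (fun x => x \in D).
Proof.
move=> mD; apply: (measurable_fun_bool true) => //; rewrite setTI.
rewrite (_ : _ @^-1` _ = D)//; apply/seteqP; split => x /=; first by move/set_mem.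
by move=> Dx; exact/mem_set.
Qed.

Lemma measurable_sup_seq (h : nat -> T -> R) : (forall x, has_ubound (range (h ^~ x))) ->
  (forall j, measurable_fun setT (h j)) ->
  measurable_fun setT (fun x => sup (range (h ^~ x))).
Proof.
move=> hub mh; have := @measurable_fun_sups _ _ _ setT h 0%N (fun x _ => hub x) mh.
rewrite (_ : (fun _ => _) = (fun x => sup (range (h ^~ x))))//.
apply/funext => x; rewrite /sups /sdrop; congr sup.
by apply/seteqP; split => _ [k _ <-]; exists k.
Qed.

(** The least such index, whose level sets are finite Boolean combinations of the
    sets [p j]. *)
Lemma measurable_first (p : nat -> T -> bool) :
  (forall j, measurable_fun setT (p j)) -> (forall x, exists j, p j x) ->
  exists2 k : T -> nat, measurable_fun setT k & forall x, p (k x) x.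
Proof.
move=> mp ex; pose k x := ex_minn (ex x); exists k; last first.
  by move=> x; rewrite /k; case: ex_minnP.
have mpj j b : measurable (p j @^-1` [set b]).
  by rewrite -[X in measurable X]setTI; exact: mp.
have mk j : measurable (k @^-1` [set j]).
  rewrite (_ : _ @^-1` _ = (p j @^-1` [set true]) `&`
     \bigcap_(i in [set i | (i < j)%N]) (p i @^-1` [set false])).
    by apply: measurableI => //; apply: bigcap_measurableType.
  apply/seteqP; split => x /=.
    rewrite /k; case: ex_minnP => m pm mmin mj; subst m; split => // i ij /=.
    by apply/negP => /mmin; rewrite leqNgt ij.
  move=> [pj h]; rewrite /k; case: ex_minnP => m pm mmin.
  apply/eqP; rewrite eqn_leq mmin//= leqNgt; apply/negP => mj.
  by have := h m mj; rewrite /= pm.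
move=> _ Y mY; rewrite setTI (_ : k @^-1` Y = \bigcup_(j in Y) (k @^-1` [set j])).
  exact: bigcup_measurable.
by apply/seteqP; split => [x Yx|x [j Yj] /= ->//]; exists (k x).
Qed.

End measurable_tools.

Lemma le_geometric0 (R : realType) (a C th : R) : 0 <= th < 1 ->
  (forall k, a <= C * th ^+ k) -> a <= 0.
Proof.
move=> /andP[th0 th1] h; rewrite leNgt; apply/negP => a0.
have : geometric C th @ \oo --> 0 by apply: cvg_geometric; rewrite ger0_norm.
move=> /cvgrPdist_lt /(_ _ a0) [k _ /(_ k (leqnn _))] /=.
rewrite sub0r normrN => /(le_lt_trans (ler_norm _)).
by rewrite ltNge h.
Qed.

(** The theory of the equation only uses one-move expectations: [tr y z] is the
    displacement produced by the jump [z] in direction [y], [yd] enumerates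
    enough directions to compute suprema over [S], and [th] bounds the
    probability of staying in [D]. *)
Section dpp.
Context {R : realType} {m : nat}.
Local Notation V := 'rV[R]_m.
Variables (Q : probability V R) (S : set V) (tr : V -> V -> V) (yd : nat -> V).
Variables (D : set V) (th : R).
Hypothesis mtr : forall y, S y -> measurable_fun setT (tr y).
Hypothesis ydS : forall j, S (yd j).

Definition move_avg (u : V -> R) (x y : V) : R := \int[Q]_z u (x + tr y z).
Local Notation c := move_avg.

Hypothesis c_approx : forall (u : V ->
  R) (x y : V) (eta : R), bounded_measurable u -> S y -> 0 < eta ->
  exists j, `|c u x (yd j) - c u x y| < eta.
Hypothesis mD : measurable D.
Hypothesis th01 : 0 <= th < 1.
Hypothesis exitD : forall x y, D x -> S y -> c \1_D x y <= th.

Lemma bm_ind : bounded_measurable (\1_D : V -> R).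
Proof.
split; first exact: measurable_indic.
by exists 1 => x; rewrite indicE; case: (_ \in _); rewrite ?normr1 ?normr0.
Qed.

Lemma bm_move2 (u : V -> R) y : bounded_measurable u -> S y ->
  bounded_measurable (fun p : V * V => u (p.1 + tr y p.2)).
Proof.
move=> bu Sy; apply: (bm_comp bu); apply: measurable_rVD => //.
exact: (measurableT_comp (mtr Sy)).
Qed.

Lemma bm_move (u : V -> R) x y : bounded_measurable u -> S y ->
  bounded_measurable (fun z => u (x + tr y z)).
Proof. by move=> bu Sy; exact: (bm_pair1 x (bm_move2 bu Sy)). Qed.

Lemma bm_move_avg (u : V -> R) y : bounded_measurable u -> S y ->
  bounded_measurable (fun x => c u x y).
Proof. by move=> bu Sy; exact: (bm_fubini Q (bm_move2 bu Sy)). Qed.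

Lemma move_avg_le u v (t : R) x y : bounded_measurable u -> bounded_measurable v -> S y ->
  (forall z, u z <= v z + t * \1_D z) -> c u x y <= c v x y + t * c \1_D x y.
Proof.
move=> bu bv Sy uv; have b1 := bm_move x bm_ind Sy.
rewrite /c -bmE_Z// -bmE_D//; [|exact: bm_move|exact: bmZ].
apply: bmE_le => //; first exact: bm_move.
by apply: bmD; [exact: bm_move|exact: bmZ].
Qed.

Lemma move_avgN u x y : bounded_measurable u -> S y -> c (fun z => - u z) x y = - c u x y.
Proof. by move=> bu Sy; rewrite /c bmE_N//; exact: bm_move. Qed.

Lemma move_avg_norm u M x y : bounded_measurable u -> (forall z, `|u z| <= M) ->
  S y -> `|c u x y| <= M.
Proof. by move=> bu uM Sy; apply: bmE_norm => //; exact: bm_move. Qed.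

Definition sup_avg u x : R := sup [set c u x y | y in S].
Definition inf_avg u x : R := inf [set c u x y | y in S].
Definition tug_avg u x : R := 2^-1 * (sup_avg u x + inf_avg u x).

Lemma move_avg_ubound u x : bounded_measurable u -> has_ubound [set c u x y | y in S].
Proof.
move=> bu; have [M uM] := bu.2; exists M => _ [y Sy <-].
by have := move_avg_norm x bu uM Sy; rewrite ler_norml => /andP[].
Qed.

Lemma move_avg_nonempty u x : [set c u x y | y in S] !=set0.
Proof. by exists (c u x (yd 0%N)); exists (yd 0%N). Qed.

Lemma sup_avg_ge u x y : bounded_measurable u -> S y -> c u x y <= sup_avg u x.
Proof. by move=> bu Sy; apply: ub_le_sup; [exact: move_avg_ubound|exists y]. Qed.

Lemma sup_avg_le u x t : (forall y, S y -> c u x y <= t) -> sup_avg u x <= t.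
Proof.
move=> h; apply: ge_sup; first exact: move_avg_nonempty.
by move=> _ [y Sy <-]; exact: h.
Qed.

Lemma inf_avgE u x : bounded_measurable u -> inf_avg u x = - sup_avg (fun z => - u z) x.
Proof.
move=> bu; rewrite /inf_avg /inf /sup_avg; congr (- sup _).
apply/seteqP; split => [_ [_ [y Sy <-] <-]|_ [y Sy <-]].
  by exists y => //; rewrite move_avgN.
by exists (c u x y); [exists y|rewrite move_avgN].
Qed.

Lemma tug_avgE u x : bounded_measurable u ->
  tug_avg u x = 2^-1 * (sup_avg u x - sup_avg (fun z => - u z) x).
Proof. by move=> bu; rewrite /tug_avg inf_avgE. Qed.

Lemma tug_avgN u x : bounded_measurable u -> tug_avg (fun z => - u z) x = - tug_avg u x.
Proof.
move=> bu; rewrite !tug_avgE//; last exact: bmN.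
rewrite (_ : (fun z => - - u z) = u); last by apply/funext => z; rewrite opprK.
by ring.
Qed.

(** An excess of [t] supported in [D] is felt only if the move stays in [D]: this is
    the contraction estimate, and with [t = 0] the monotonicity. *)
Lemma sup_avg_mono u v (t : R) x : bounded_measurable u -> bounded_measurable v ->
  0 <= t -> D x ->
  (forall z, u z <= v z + t * \1_D z) -> sup_avg u x <= sup_avg v x + th * t.
Proof.
move=> bu bv t0 Dx uv; apply: sup_avg_le => y Sy.
rewrite (le_trans (move_avg_le x bu bv Sy uv))// lerD ?sup_avg_ge//.
by rewrite mulrC ler_wpM2r ?exitD.
Qed.

Lemma tug_avg_mono u v (t : R) x : bounded_measurable u -> bounded_measurable v ->
  0 <= t -> D x ->
  (forall z, u z <= v z + t * \1_D z) -> tug_avg u x <= tug_avg v x + th * t.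
Proof.
move=> bu bv t0 Dx uv; rewrite !tug_avgE//.
have h1 := sup_avg_mono bu bv t0 Dx uv.
have h2 : sup_avg (fun z => - v z) x <= sup_avg (fun z => - u z) x + th * t.
  apply: sup_avg_mono => //; [exact: bmN|exact: bmN|] => z.
  by have := uv z; lra.
lra.
Qed.

(** The supremum over the sphere is that of a sequence, hence measurable in [x]. *)
Lemma sup_avg_dense u x : bounded_measurable u ->
  sup_avg u x = sup (range (fun j => c u x (yd j))).
Proof.
move=> bu; apply/eqP; rewrite eq_le; apply/andP; split.
  apply: sup_avg_le => y Sy; apply/ler_addgt0Pr => e e0.
  have [j] := c_approx x bu Sy e0.
  rewrite ltr_norml => /andP[h _].
  have : c u x (yd j) <= sup (range (fun j => c u x (yd j))).
    apply: ub_le_sup; last by exists j.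
    by have [B hB] := move_avg_ubound x bu; exists B => _ [k _ <-]; apply: hB;
      exists (yd k).
  by move: h; lra.
apply: ge_sup; first by exists (c u x (yd 0%N)); exists 0%N.
by move=> _ [k _ <-]; exact: sup_avg_ge.
Qed.

Lemma bm_sup_avg u : bounded_measurable u -> bounded_measurable (sup_avg u).
Proof.
move=> bu; split.
  rewrite (_ : sup_avg u = fun x => sup (range (fun j => c u x (yd j)))); last first.
    by apply/funext => x; exact: sup_avg_dense.
  apply: (measurable_sup_seq (h := fun j x => c u x (yd j))) => [x|j]; last first.
    by have [] := bm_move_avg bu (ydS j).
  by have [B hB] := move_avg_ubound x bu; exists B => _ [k _ <-]; apply: hB;
    exists (yd k).
have [M uM] := bu.2; exists M => x; rewrite ler_norml; apply/andP; split.
  rewrite (le_trans _ (sup_avg_ge x bu (ydS 0%N)))//.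
  by have := move_avg_norm x bu uM (ydS 0%N); rewrite ler_norml => /andP[].
apply: sup_avg_le => y Sy.
by have := move_avg_norm x bu uM Sy; rewrite ler_norml => /andP[].
Qed.

Lemma bm_tug_avg u : bounded_measurable u -> bounded_measurable (tug_avg u).
Proof.
move=> bu; rewrite (_ : tug_avg u = fun x => 2^-1 * (sup_avg u x - sup_avg (fun z =>
  - u z) x)).
  by apply: bmZ; apply: bmB; [exact: bm_sup_avg|apply: bm_sup_avg; exact: bmN].
by apply/funext => x; exact: tug_avgE.
Qed.

Lemma near_optimal u eta : bounded_measurable u -> 0 < eta ->
  exists sel : V -> V, [/\ measurable_fun setT sel, forall x, S (sel x) &
    forall x, sup_avg u x - eta <= c u x (sel x)].
Proof.
move=> bu eta0; pose p j x := sup_avg u x - eta < c u x (yd j).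
have [||k mk kP] := @measurable_first _ _ p.
- move=> j; apply: measurable_fun_ltr; last by have [] := bm_move_avg bu (ydS j).
  by apply: measurable_funB => //; have [] := bm_sup_avg bu.
- move=> x; have : sup_avg u x - eta < sup (range (fun j => c u x (yd j))).
    by rewrite -sup_avg_dense// ltrBlDr ltrDl.
  by move=> /sup_gt [|_ [j _ <-] h]; [exists (c u x (yd 0%N)); exists 0%N|exists j].
exists (yd \o k); split => [|x|x] /=; first exact: measurableT_comp.
  exact: ydS.
exact/ltW/kP.
Qed.

Section solution.
Variable F : V -> R.
Hypothesis bF : bounded_measurable F.

Definition dpp_map u x := if x \in D then tug_avg u x else F x.

Lemma bm_dpp_map u : bounded_measurable u -> bounded_measurable (dpp_map u).
Proof.
move=> bu; apply: bm_if => //; [exact: measurable_mem|exact: bm_tug_avg].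
Qed.

Lemma dpp_map_mono u v t : bounded_measurable u -> bounded_measurable v -> 0 <= t ->
  (forall z, u z <= v z + t * \1_D z) ->
  forall z, dpp_map u z <= dpp_map v z + (th * t) * \1_D z.
Proof.
move=> bu bv t0 uv z; rewrite /dpp_map indicE.
case: ifPn => /= zD; last by rewrite mulr0 addr0.
by rewrite mulr1; apply: tug_avg_mono => //; exact/set_mem.
Qed.

Definition dpp_sol u := [/\ bounded_measurable u, forall x, D x -> u x = tug_avg u x &
  forall x, ~ D x -> u x = F x].

Lemma dpp_solE u : dpp_sol u -> dpp_map u = u.
Proof.
move=> [_ uD uF]; apply/funext => x; rewrite /dpp_map; case: ifPn => xD.
  by rewrite -uD//; exact/set_mem.
by rewrite -uF// => /mem_set; exact/negP.
Qed.

(** Iterating [dpp_map_mono] from a common bound of [u] and [v], which agree off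
    [D]. *)
Lemma dpp_unique u v : dpp_sol u -> dpp_sol v -> forall x, u x <= v x.
Proof.
move=> su sv; have [bu uD uF] := su; have [bv vD vF] := sv.
have [Mu uM] := bu.2; have [Mv vM] := bv.2.
have M0 : 0 <= Mu + Mv.
  by rewrite addr_ge0// (le_trans (normr_ge0 _) (uM 0), le_trans (normr_ge0 _) (vM 0)).
have h k x : u x <= v x + ((Mu + Mv) * th ^+ k) * \1_D x.
  elim: k x => [|k IH] x.
    rewrite expr0 mulr1 indicE; case: (boolP (x \in D)) => xD /=.
      have := uM x; have := vM x; rewrite !ler_norml mulr1; lra.
    have nD : ~ D x by move=> /mem_set; exact/negP.
    by rewrite mulr0 addr0 uF// vF.
  have th0 : 0 <= th by case/andP: th01.
  have := dpp_map_mono bu bv (mulr_ge0 M0 (exprn_ge0 k th0)) IH x.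
  by rewrite !dpp_solE// exprS mulrCA.
move=> x; rewrite -subr_le0; apply: (@le_geometric0 _ _ (Mu + Mv) th) => // k.
have := h k x; rewrite indicE; case: (_ \in _); first by rewrite mulr1; lra.
have th0 : 0 <= th by case/andP: th01.
have := mulr_ge0 M0 (exprn_ge0 k th0); rewrite mulr0; lra.
Qed.

(** The iterates [lo k] of a subsolution increase, the iterates [hi k] of a
    supersolution decrease, [lo k <= hi k], and they get [th ^ k] close by the
    contraction estimate.  The supremum of the [lo k] lies between them, hence so
    does its image under [dpp_map], one step later. *)
Lemma dpp_exists : exists u, dpp_sol u.
Proof.
have th0 : 0 <= th by case/andP: th01.
have [M FM] := bF.2; have M0 : 0 <= M := le_trans (normr_ge0 _) (FM 0).
pose lo0 x := if x \in D then - M else F x.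
pose hi0 x := if x \in D then M else F x.
have blo0 : bounded_measurable lo0 by apply: bm_if => //;
  [exact: measurable_mem|exact: bm_cst].
have bhi0 : bounded_measurable hi0 by apply: bm_if => //;
  [exact: measurable_mem|exact: bm_cst].
pose lo k := iter k dpp_map lo0; pose hi k := iter k dpp_map hi0.
have blo k : bounded_measurable (lo k) by elim: k => // k IH; exact: bm_dpp_map.
have bhi k : bounded_measurable (hi k) by elim: k => // k IH; exact: bm_dpp_map.
have mono u v : bounded_measurable u -> bounded_measurable v ->
  (forall x, u x <= v x) -> forall x, dpp_map u x <= dpp_map v x.
  move=> bu bv uv x; have := dpp_map_mono bu bv (lexx 0) _ x.
  by rewrite mulr0 mul0r addr0; apply => z; rewrite mul0r addr0.
have bnd u x : bounded_measurable u -> (forall z, `|u z| <= M) -> `|tug_avg u x| <= M.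
  move=> bu uM; rewrite tug_avgE//.
  have sb w : bounded_measurable w -> (forall z, `|w z| <= M) -> `|sup_avg w x| <= M.
    move=> bw wM; rewrite ler_norml; apply/andP; split.
      rewrite (le_trans _ (sup_avg_ge x bw (ydS 0%N)))//.
      by have := move_avg_norm x bw wM (ydS 0%N); rewrite ler_norml => /andP[].
    apply: sup_avg_le => y Sy.
    by have := move_avg_norm x bw wM Sy; rewrite ler_norml => /andP[].
  have := sb _ bu uM; have := sb _ (bmN bu) (fun z => eq_ind_r (fun t =>
    t <= M) (uM z) (normrN _)).
  rewrite !ler_norml => /andP[a1 a2] /andP[a3 a4]; apply/andP; split; lra.
have lo0M z : `|lo0 z| <= M by rewrite /lo0; case: ifPn => // _; rewrite normrN ger0_norm.
have hi0M z : `|hi0 z| <= M by rewrite /hi0; case: ifPn => // _; rewrite ger0_norm.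
have loS k x : lo k x <= lo k.+1 x.
  elim: k x => [|k IH]; last by exact: (mono _ _ (blo k) (blo k.+1)).
  move=> x; rewrite /lo /= /dpp_map {1}/lo0; case: ifPn => // xD.
  by have := bnd _ x blo0 lo0M; rewrite ler_norml => /andP[].
have hiS k x : hi k.+1 x <= hi k x.
  elim: k x => [|k IH]; last by exact: (mono _ _ (bhi k.+1) (bhi k)).
  move=> x; rewrite /hi /= /dpp_map {2}/hi0; case: ifPn => // xD.
  by have := bnd _ x bhi0 hi0M; rewrite ler_norml => /andP[].
have lohi k x : lo k x <= hi k x.
  elim: k x => [|k IH]; last by exact: (mono _ _ (blo k) (bhi k)).
  by move=> x; rewrite /lo /hi /= /lo0 /hi0; case: ifPn => // _; lra.
have hilo k x : hi k x <= lo k x + (2 * M * th ^+ k) * \1_D x.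
  elim: k x => [|k IH] x.
    rewrite /lo /hi /lo0 /hi0 /= indicE expr0; case: (_ \in _);
      last by rewrite mulr0 addr0.
    by rewrite !mulr1; lra.
  have := dpp_map_mono (bhi k) (blo k) _ IH x.
  by rewrite exprS [th * (_ * _)]mulrCA; apply; rewrite !mulr_ge0 ?exprn_ge0.
have loj j k x : (j <= k)%N -> lo j x <= lo k x.
  move=> /subnKC <-; elim: (k - j)%N => [|i IH]; first by rewrite addn0.
  by rewrite addnS (le_trans IH).
have hij j k x : (j <= k)%N -> hi k x <= hi j x.
  move=> /subnKC <-; elim: (k - j)%N => [|i IH]; first by rewrite addn0.
  by rewrite addnS (le_trans _ IH).
have lohi' j k x : lo j x <= hi k x.
  case: (leqP j k) => jk; first by apply: (le_trans (loj _ _ x jk)); exact: lohi.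
  by apply: (le_trans (lohi j x)); exact: hij (ltnW jk).
pose u x := sup (range (lo ^~ x)).
have ub x : has_ubound (range (lo ^~ x)) by exists (hi 0%N x) => _ [k _ <-].
have lou k x : lo k x <= u x by apply: ub_le_sup => //; exists k.
have uhi k x : u x <= hi k x.
  by apply: ge_sup; [exists (lo 0%N x); exists 0%N|move=> _ [j _ <-]].
have bu : bounded_measurable u.
  split; first by apply: measurable_sup_seq => // j; have [] := blo j.
  exists M => x; rewrite ler_norml; apply/andP; split.
    by rewrite (le_trans _ (lou 0%N x))//; have := lo0M x; rewrite ler_norml => /andP[].
  by rewrite (le_trans (uhi 0%N x))//; have := hi0M x; rewrite ler_norml => /andP[].
have ulo k x : u x <= lo k x + (2 * M * th ^+ k) * \1_D x.
  exact: le_trans (uhi k x) (hilo k x).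
have Tlo k x : dpp_map (lo k) x <= dpp_map u x by apply: mono.
have TE : dpp_map u = u.
  apply/funext => x.
  have cd k : 0 <= 2 * M * th ^+ k * \1_D x :> R.
    by rewrite !mulr_ge0 ?exprn_ge0// indicE.
  have cdl k : 2 * M * th ^+ k * \1_D x <= 2 * M * th ^+ k :> R.
    rewrite indicE; case: (_ \in _); rewrite ?mulr1// mulr0.
    by rewrite !mulr_ge0 ?exprn_ge0.
  apply/eqP; rewrite eq_le; apply/andP; split; rewrite -subr_le0;
      apply: (@le_geometric0 _ _ (2 * M) th) => // k.
    have c0 : 0 <= 2 * M * th ^+ k by rewrite !mulr_ge0 ?exprn_ge0.
    have := dpp_map_mono bu (blo k) c0 (ulo k) x.
    have -> : th * (2 * M * th ^+ k) = 2 * M * th ^+ k.+1 by rewrite exprS; ring.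
    have -> : dpp_map (lo k) x = lo k.+1 x by [].
    have := lou k.+1 x; have := cdl k.+1.
    have : 2 * M * th ^+ k.+1 <= 2 * M * th ^+ k.
      by rewrite exprS [th * _]mulrC mulrA ler_piMr// ltW//; case/andP: th01.
    lra.
  have : lo k.+1 x <= dpp_map u x := Tlo k x; have := ulo k.+1 x; have := cdl k.+1.
  have : 2 * M * th ^+ k.+1 <= 2 * M * th ^+ k.
    by rewrite exprS [th * _]mulrC mulrA ler_piMr ?mulr_ge0 ?exprn_ge0// ltW//;
      case/andP: th01.
  lra.
exists u; split => // x.
  by move=> Dx; rewrite -[LHS](congr1 (@^~ x) TE) /dpp_map mem_set.
by move=> nDx; rewrite -[LHS](congr1 (@^~ x) TE) /dpp_map memNset.
Qed.

End solution.
End dpp.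

(** * Independent rounds *)

Section iid.
Context {R : realType} d {T : measurableType d}.
Local Notation W := (seqspace T).

Lemma measurable_coord i : measurable_fun setT (fun w : W => w i).
Proof.
move=> _ A mA; rewrite setTI; apply: sub_sigma_algebra; exists i => //.
by exists A => //; rewrite setTI.
Qed.

Lemma measurable_seqspace d' (T' : measurableType d') (f : T' -> W) :
  (forall i, measurable_fun setT (fun t => f t i)) -> measurable_fun setT f.
Proof.
move=> mf; apply: (measurability _ (erefl (@seqspace_measurable _ T))).
move=> _ [_ [i _ [A mA <-]] <-]; rewrite !setTI.
by have := mf i measurableT A mA; rewrite setTI.
Qed.

(** The past before time [k], kept as a full sequence so as to stay in the same
    measurable space; the default [point] replaces the later rounds. *)
Definition trunc k (w : W) : W := fun i => if (i < k)%N then w i else point.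

Lemma measurable_trunc k : measurable_fun setT (trunc k).
Proof.
apply: measurable_seqspace => i; rewrite /trunc /=; case: (i < k)%N => //.
exact: measurable_coord.
Qed.

Definition cylinder m (C : nat -> set T) : set W := [set w | forall i, (i < m)%N ->
  C i (w i)].

Definition cylinders : set (set W) :=
  [set A | exists m C, (forall i, measurable (C i)) /\ A = cylinder m C].

Lemma measurable_cylinder m C : (forall i, measurable (C i)) -> measurable (cylinder m C).
Proof.
move=> mC; rewrite (_ : cylinder m C = \bigcap_(i in [set i | (i < m)%N]) ((fun w : W
  => w i) @^-1` C i)).
  apply: bigcap_measurableType => i _; rewrite -[X in measurable X]setTI.
  exact: measurable_coord.
by apply/seteqP; split => w h i im; exact: h.
Qed.

Lemma measurable_cylinders : (measurable : set (set W)) = <<s cylinders >>.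
Proof.
apply/seteqP; split.
  apply: smallest_sub; first exact: smallest_sigma_algebra.
  move=> _ [i _ [A mA <-]]; rewrite setTI; apply: sub_gen_smallest.
  exists i.+1, (fun j => if j == i then A else setT); split.
    by move=> j; case: ifPn.
  apply/seteqP; split => w /=.
    by move=> Aw j _; case: eqP => [->|].
  by move=> /(_ i (ltnSn i)); rewrite eqxx.
apply: smallest_sub; first exact: sigma_algebra_measurable.
by move=> _ [m [C [mC ->]]]; exact: measurable_cylinder.
Qed.

Lemma setI_closed_cylinders : setI_closed cylinders.
Proof.
move=> _ _ [m [C [mC ->]]] [m' [C' [mC' ->]]].
exists (maxn m m'), (fun i => (if (i < m)%N then C i else setT) `&` (if (i < m')%N
  then C' i else setT)).
split; first by move=> i; apply: measurableI; case: ifPn.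
apply/seteqP; split => w /=.
  by move=> [h h'] i _; split; case: ifPn => // im; [exact: h|exact: h'].
move=> h; split => i im.
  by have := h i; rewrite leq_max im => /(_ isT)[].
by have := h i; rewrite leq_max im orbT => /(_ isT)[].
Qed.

Variables (P : probability W R) (Q : probability T R).
Hypothesis PQ : iid_law P Q.

Section fixed_time.
Variable k : nat.

Definition past_law : set W -> \bar R := mimage P (measurable_trunc k).
HB.instance Definition _ := Measure.on past_law.
Let past_lawT : past_law setT = 1%E.
Proof. by rewrite /past_law /mimage /pushforward preimage_setT probability_setT. Qed.
HB.instance Definition _ := Measure_isProbability.Build _ _ _ past_law past_lawT.

Let split_map (w : W) : W * T := (trunc k w, w k).

Let measurable_split_map : measurable_fun setT split_map.
Proof.
by apply/measurable_fun_pairP; split; [exact: measurable_trunc|exact: measurable_coord].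
Qed.

Let next_cylinder m C (B : set T) : (forall i, measurable (C i)) -> measurable B ->
  P (trunc k @^-1` cylinder m C `&` (fun w => w k) @^-1` B) =
  (P (trunc k @^-1` cylinder m C) * Q B)%E.
Proof.
move=> mC mB.
(* The constraints at times [i >= k] bear on the constant [point]. *)
have [Cp|nCp] := pselect (forall i, (k <= i < m)%N -> C i point); last first.
  rewrite (_ : trunc k @^-1` _ = set0) ?set0I ?measure0 ?mul0e//.
  apply/seteqP; split => // w /= h; apply: nCp => i /andP[ki im].
  by have := h i im; rewrite /trunc ltnNge ki.
pose E i := if (i < m)%N then C i else setT.
pose E' i := if i == k then B else E i.
have mE i : measurable (E i) by rewrite /E; case: ifPn.
have mE' i : measurable (E' i) by rewrite /E'; case: ifPn.
have H1 : trunc k @^-1` cylinder m C = cylinder k E.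
  apply/seteqP; split => w /= h i ik.
    by rewrite /E; case: ifPn => // im; have := h i im; rewrite /trunc ik.
  rewrite /trunc; case: ifPn => [ik'|]; first by have := h i ik'; rewrite /E ik.
  by rewrite -leqNgt => ki; apply: Cp; rewrite ki.
have H2 : trunc k @^-1` cylinder m C `&` (fun w => w k) @^-1` B = cylinder k.+1 E'.
  rewrite H1; apply/seteqP; split => w /=.
    move=> [h hB] i; rewrite ltnS /E'; case: eqP => [->//|/eqP ik].
    by rewrite leq_eqVlt (negbTE ik)/= => /h.
  move=> h; split => [i ik|]; last by have := h k (ltnSn k); rewrite /E' eqxx.
  by have := h i (ltnW ik); rewrite /E' ltn_eqF.
have := PQ k.+1 mE'; have := PQ k mE; rewrite /cylinder in H1 H2.
rewrite H2 H1 => -> ->; rewrite big_ord_recr /= /E' eqxx; congr (_ * _)%E.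
by apply: eq_bigr => i _; rewrite ltn_eqF.
Qed.

Let next_rect (A : set W) (B : set T) : measurable A -> measurable B ->
  P (split_map @^-1` (A `*` B)) = (past_law A * Q B)%E.
Proof.
move=> mA mB.
have mB' : measurable ((fun w : W => w k) @^-1` B).
  by rewrite -[X in measurable X]setTI; exact: measurable_coord.
pose m1 := mimage (mrestr P mB') (measurable_trunc k).
have q0 : 0 <= fine (Q B) by exact: fine_ge0.
have QB : Q B = (fine (Q B))%:E by rewrite fineK// fin_num_measure.
pose m2 := mscale (NngNum q0) past_law.
have m2E X : m2 X = (past_law X * Q B)%E by rewrite muleC QB.
have m12 : forall X, cylinders X -> m1 X = m2 X.
  move=> _ [m [C [mC ->]]]; rewrite m2E.
  exact: next_cylinder.
have cylT : forall i : nat, cylinders setT.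
  by move=> _; exists 0%N, (fun _ => setT); split => //; apply/seteqP; split.
have cover : \bigcup_(k in setT) (fun _ : nat => [set: W]) k = setT.
  by apply/seteqP; split => // w _; exists 0%N.
have fin1 : forall i : nat, (m1 setT < +oo)%E.
  move=> _; rewrite /m1 /mimage /pushforward /mrestr /= preimage_setT setTI.
  exact: (le_lt_trans (probability_le1 P mB') (ltry 1)).
have := @measure_unique _ R W cylinders (fun _ => setT) measurable_cylinders
  setI_closed_cylinders cylT cover m1 m2 m12 fin1 A mA.
by move=> h; exact: (etrans h (m2E A)).
Qed.

(** Independence of the next round from the past.  The two measures agree on
    rectangles by [next_rect], where for a fixed next event the past events are
    generated by cylinders, on which the product formula defining the law
    applies. *)
Lemma iid_next (A : set (W * T)) : measurable A ->
  P (split_map @^-1` A) = (past_law \x Q)%E A.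
Proof.
move=> mA; pose m := mimage P measurable_split_map.
apply/esym; change ((past_law \x Q)%E A = m A).
by apply: product_measure_unique => // B C mB mC; exact: next_rect.
Qed.

Lemma iid_next_integral (G : W * T -> R) : bounded_measurable G ->
  (forall w r, G (trunc k w, r) = G (w, r)) ->
  \int[P]_w G (w, w k) = \int[P]_w \int[Q]_r G (w, r).
Proof.
move=> bG GE.
have Poo : (P setT < +oo)%E by exact: (le_lt_trans (probability_le1 P measurableT)
  (ltry 1)).
transitivity (\int[P]_w G (split_map w)); first by apply: eq_Rintegral => w _;
  rewrite /split_map GE.
rewrite -(Rintegral_pushforward (m :=
  mimage P measurable_split_map) Poo bG measurable_split_map)//.
rewrite (bmE_fubini (P1 := past_law) (P2 := Q) bG); last by move=> A mA; exact: iid_next.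
have E : forall A, measurable A -> past_law A = P (trunc k @^-1` A) by [].
rewrite (Rintegral_pushforward Poo (bm_fubini Q bG) (measurable_trunc k) E).
by apply: eq_Rintegral => w _; apply: eq_Rintegral => r _; rewrite GE.
Qed.

End fixed_time.
End iid.

(** A positive constant is added because the formula at hand is for nonnegative
    functions. *)
Lemma bernoulli_integral (R : realType) (f : bool -> R) :
  \int[bernoulli_prob (2^-1 : R)]_b f b = 2^-1 * (f true + f false).
Proof.
have bf : bounded_measurable f.
  split => //; exists (`|f true| + `|f false|) => -[]; rewrite ?lerDl ?lerDr//.
pose M := `|f true| + `|f false|.
have fM b : 0 <= f b + M.
  have h1 := ler_norm (- f true); have h2 := ler_norm (- f false).
  have h3 := normr_ge0 (f true); have h4 := normr_ge0 (f false).
  by rewrite !normrN in h1 h2; rewrite /M; case: b; lra.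
have := bmE_D (bernoulli_prob (2^-1 : R)) bf (bm_cst M).
have p01 : 0 <= (2^-1 : R) <= 1 by apply/andP; split; lra.
rewrite bmE_cst {1}/Rintegral (@integral_bernoulli_prob _ _ p01); last by move=> b;
  rewrite lee_fin.
by rewrite /= /unstable.onem => h; lra.
Qed.

Lemma round_integral (R : realType) d (T : measurableType d) (Q : probability T R)
    (m : {measure set (T * bool) -> \bar R}) (g : T * bool -> R) : bounded_measurable g ->
  (forall A, measurable A -> m A = (Q \x bernoulli_prob 2^-1)%E A) ->
  \int[m]_r g r = 2^-1 * (\int[Q]_z g (z, true) + \int[Q]_z g (z, false)).
Proof.
move=> bg mE; rewrite (bmE_fubini (P1 := Q) (P2 := bernoulli_prob 2^-1) bg mE).
have bb b : bounded_measurable (fun z => g (z, b)).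
  by apply: (bm_comp (h := fun z => (z, b)) bg); exact: pair2_measurable.
under eq_Rintegral do rewrite bernoulli_integral.
by rewrite bmE_Z ?bmE_D//; apply: bmD.
Qed.

Section round_prob.
Context {R : realType} d {T : measurableType d} (Q : probability T R).

Definition round_prob : set (T * bool) -> \bar R := (Q \x bernoulli_prob 2^-1)%E.
HB.instance Definition _ := Measure.on round_prob.
Let round_probT : round_prob setT = 1%E.
Proof.
rewrite /round_prob -setXTT [LHS](product_measure1E Q (bernoulli_prob 2^-1)
  measurableT measurableT).
by rewrite -[RHS]mule1; congr (_ * _)%E; exact: probability_setT.
Qed.
HB.instance Definition _ := Measure_isProbability.Build _ _ _ round_prob round_probT.

End round_prob.

(** * The game under two fixed strategies *)

Section game.
Context {R : realType} {n : nat}.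
Local Notation V := 'rV[R]_n.+2.
Local Notation round := (V * bool)%type.
Local Notation W := (seqspace round).
Local Notation history k := (V * k.-tuple (V * round))%type.
Variables (Rot : V -> V -> 'M[R]_n.+2) (eps : R) (x : V).
Hypothesis RotF : rotation_family Rot.
Variables sI sII : @strategy R n.
Hypotheses (hI : strategies sI) (hII : strategies sII).

Definition jump (y z : V) : V := eps *: mxact (Rot y e1) z.

Local Notation pos := (position Rot eps x sI sII).
Local Notation hist w k := ((play Rot eps x sI sII w k).1).

Definition chosen (w : W) k (b : bool) : V := if b then sI (hist w k) else sII (hist w k).

Lemma positionS w k : pos w k.+1 = pos w k + jump (chosen w k (w k).2) (w k).1.
Proof.
rewrite /position /chosen /jump /=.
by case: (play Rot eps x sI sII w k) => h X; case: (w k).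
Qed.

Lemma histS w k : hist w k.+1 =
  ((hist w k).1, [tuple of rcons (hist w k).2 (pos w k.+1, w k)]).
Proof.
rewrite /position /=.
by case: (play Rot eps x sI sII w k) => h X; case: (w k).
Qed.

Lemma chosen_sphere w k b : usphere (chosen w k b).
Proof. by rewrite /chosen; case: b; [case: (hI k)|case: (hII k)]. Qed.

Lemma eq_play w w' k : (forall i, (i < k)%N -> w i = w' i) ->
  play Rot eps x sI sII w k = play Rot eps x sI sII w' k.
Proof.
elim: k => //= k IH ww; rewrite IH ?ww//.
by move=> i ik; rewrite ww// ltnW.
Qed.

Lemma measurable_rcons d (T : measurableType d) d' (T' : measurableType d') k
    (f : T -> k.-tuple T') (g : T -> T') :
  measurable_fun setT f -> measurable_fun setT g ->
  measurable_fun setT (fun t => [tuple of rcons (f t) (g t)] : k.+1.-tuple T').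
Proof.
move=> mf mg; apply/measurable_fun_tnthP => i.
have [ik|ki] := ltnP i k.
  rewrite (_ : _ \o _ = fun t => tnth (f t) (Ordinal ik)).
    by apply: (measurableT_comp (f := fun x => tnth x (Ordinal ik))) => //;
      exact: measurable_tnth.
  apply/funext => t /=; rewrite (tnth_nth (g t)) /= nth_rcons size_tuple ik.
  by rewrite (tnth_nth (g t)).
rewrite (_ : _ \o _ = g)//; apply/funext => t /=;
  rewrite (tnth_nth (g t)) /= nth_rcons size_tuple.
by rewrite ltnNge ki/=; case: ifP.
Qed.

Lemma measurable_chosen d (T : measurableType d) k (w : T -> W) (b : T -> bool) :
  measurable_fun setT (fun t => hist (w t) k) -> measurable_fun setT b ->
  measurable_fun setT (fun t => chosen (w t) k (b t)).
Proof.
move=> mh mb; apply: measurable_fun_ifT => //.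
  by case: (hI k) => ms _; exact: (measurableT_comp ms mh).
by case: (hII k) => ms _; exact: (measurableT_comp ms mh).
Qed.

Lemma measurable_play k : measurable_fun setT (fun w => hist w k) /\
  measurable_fun setT (fun w => pos w k).
Proof.
elim: k => [|k [mh mp]]; first by split; exact: measurable_cst.
have mw : measurable_fun setT (fun w : W => w k) by exact: measurable_coord.
have mp1 : measurable_fun setT (fun w => pos w k.+1).
  under eq_fun do rewrite positionS.
  apply: measurable_rVD => //; apply: measurable_rVZ => //.
  apply: measurable_rotation => //.
  - by apply: measurable_chosen => //; exact: (measurableT_comp measurable_snd mw).
  - exact: (measurableT_comp measurable_fst mw).
  - by move=> w; exact: chosen_sphere.
split => //; under eq_fun do rewrite histS.
apply/measurable_fun_pairP; split; first exact: (measurableT_comp measurable_fst mh).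
apply: measurable_rcons; first exact: (measurableT_comp measurable_snd mh).
by apply/measurable_fun_pairP; split.
Qed.

Section stopped.
Variables (Q : probability V R) (P : probability W R) (D : set V) (F : V -> R).
Hypothesis PQ : iid_law P (round_prob Q).
Hypothesis mD : measurable D.
Hypothesis bF : bounded_measurable F.

Local Notation c := (move_avg Q jump).

Fixpoint alive (w : W) k : bool :=
  if k is k'.+1 then alive w k' && (pos w k \in D) else x \in D.

(** [u (X_k)] stopped at the exit time. *)
Fixpoint stopped (u : V -> R) (w : W) k : R :=
  if k is k'.+1 then if alive w k' then u (pos w k) else stopped u w k' else u x.

Lemma alive_pos w k i : alive w k -> (i <= k)%N -> D (pos w i).
Proof.
elim: k => [|k IH] /=; first by rewrite leqn0 => xD /eqP ->; exact/set_mem.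
move=> /andP[ak pD]; rewrite leq_eqVlt => /orP[/eqP ->|]; first exact/set_mem.
by rewrite ltnS; exact: IH.
Qed.

Lemma stopped_alive u w k : alive w k -> stopped u w k = u (pos w k).
Proof. by case: k => //= k /andP[-> _]. Qed.

Lemma alive_le w k l : (k <= l)%N -> alive w l -> alive w k.
Proof.
move=> /subnKC <-; elim: (l - k)%N => [|i IH]; first by rewrite addn0.
by rewrite addnS /= => /andP[/IH].
Qed.

Lemma payoff_exit w k : ~ D (pos w k) -> (forall i, (i < k)%N -> D (pos w i)) ->
  payoff Rot eps x sI sII D F w = F (pos w k).
Proof.
move=> nD Di; rewrite /payoff /exit_time; case: pselect => [ex|nex]; last first.
  by exfalso; apply: nex; exists k; apply/asboolP.
case: ex_minnP => m /asboolP mD' mmin; congr (F (pos w _)).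
apply/eqP; rewrite eqn_leq; apply/andP; split; first by apply: mmin; apply/asboolP.
by rewrite leqNgt; apply/negP => /Di.
Qed.

(** After the exit the stopped process is constant, equal to the value of [u] at the
    exit point, where [u] is [F]. *)
Lemma payoff_dead u w k : (forall z, ~ D z -> u z = F z) ->
  ~~ alive w k -> stopped u w k = payoff Rot eps x sI sII D F w.
Proof.
move=> uF; elim: k => [|k IH] /=.
  move=> xD; have nD : ~ D x by move/mem_set; exact/negP.
  by rewrite (@payoff_exit w 0%N)//; exact: uF.
case: ifPn => ak /=; last by move=> _; exact: IH.
move=> pD; have nD : ~ D (pos w k.+1) by move/mem_set; exact/negP.
by rewrite (@payoff_exit w k.+1)// ?uF// => i; rewrite ltnS; exact: alive_pos.
Qed.

Lemma payoff_forever w : (forall k, alive w k) -> payoff Rot eps x sI sII D F w = 0.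
Proof.
move=> al; rewrite /payoff /exit_time; case: pselect => // ex; exfalso.
by case: ex => k /asboolP; apply; exact: (alive_pos (al k) (leqnn k)).
Qed.

Lemma measurable_alive k : measurable_fun setT (alive ^~ k).
Proof.
elim: k => [|k IH]; first exact: measurable_cst.
apply: measurable_and => //.
exact: (measurableT_comp (measurable_mem mD) (measurable_play k.+1).2).
Qed.

Lemma bm_pos (g : V -> R) k : bounded_measurable g ->
  bounded_measurable (fun w => g (pos w k)).
Proof. by move=> bg; exact: (bm_comp bg (measurable_play k).2). Qed.

Lemma bm_stopped (u : V -> R) k : bounded_measurable u ->
  bounded_measurable (fun w => stopped u w k).
Proof.
move=> bu; elim: k => [|k IH]; first exact: bm_cst.
apply: bm_if => //; [exact: measurable_alive|exact: bm_pos].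
Qed.

Definition alive_ind w k : R := if alive w k then 1 else 0.

Lemma bm_alive k : bounded_measurable (alive_ind ^~ k).
Proof. by apply: bm_if; [exact: measurable_alive|exact: bm_cst|exact: bm_cst]. Qed.

(** The payoff is the pointwise limit of the stopped process set to [0] while the
    game is running; a game that never stops has payoff [0]. *)
Lemma bm_payoff : bounded_measurable (payoff Rot eps x sI sII D F).
Proof.
have [M FM] := bF.2; have M0 : 0 <= M := le_trans (normr_ge0 _) (FM 0).
split; last first.
  by exists M => w; rewrite /payoff; case: exit_time => [k|]; rewrite ?normr0.
pose Z k w := if alive w k then 0 else stopped F w k.
apply: (measurable_fun_cvg (h := Z)).
  move=> k; apply: measurable_fun_ifT => //; first exact: measurable_alive.
  by case: (bm_stopped k bF).
move=> w _; have [al|/existsNP[k /negP nk]] := pselect (forall k, alive w k).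
  rewrite (payoff_forever al) (_ : Z ^~ w = fun=> 0); first exact: cvg_cst.
  by apply/funext => k; rewrite /Z al.
apply: cvg_near_cst; exists k => // j /= kj.
have nj : ~~ alive w j by apply: contra nk; exact: alive_le.
by rewrite /Z (negbTE nj) (payoff_dead _ nj).
Qed.

Definition both_avg g w k : R :=
  2^-1 * (c g (pos w k) (chosen w k true) + c g (pos w k) (chosen w k false)).

Lemma measurable_jump y : usphere y -> measurable_fun setT (jump y).
Proof. by move=> yS; apply: measurable_rVZ => //; exact: measurable_mxact. Qed.

(** The position at time [k.+1] is a function of the past and of the round [k],
    which is independent of it; integrate that round first. *)
Lemma one_step (g : V -> R) k : bounded_measurable g ->
  bounded_measurable (fun w => alive_ind w k * both_avg g w k) /\
  \int[P]_w (alive_ind w k * g (pos w k.+1)) = \int[P]_w (alive_ind w k * both_avg g w k).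
Proof.
move=> bg.
pose nxt (p : W * round) := pos p.1 k + jump (chosen p.1 k p.2.2) p.2.1.
have mnxt : measurable_fun setT nxt.
  apply: measurable_rVD; first exact: (measurableT_comp (measurable_play k).2).
  apply: measurable_rVZ => //; apply: measurable_rotation => //.
  - apply: measurable_chosen; last exact: (measurableT_comp measurable_snd).
    exact: (measurableT_comp (measurable_play k).1).
  - exact: (measurableT_comp measurable_fst).
  - by move=> p; exact: chosen_sphere.
pose G (p : W * round) := alive_ind p.1 k * g (nxt p).
have bG : bounded_measurable G.
  apply: bmM; first exact: (bm_comp (h := fst) (bm_alive k)).
  exact: (bm_comp bg mnxt).
have truncE w j : (j <= k)%N -> play Rot eps x sI sII (trunc k w) j = play Rot eps x
  sI sII w j.
  by move=> jk; apply: eq_play => i ij; rewrite /trunc (leq_trans ij jk).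
have aliveE w j : (j <= k)%N -> alive (trunc k w) j = alive w j.
  by elim: j => //= j IH jk; rewrite IH ?(ltnW jk)// /position truncE.
have GE w r : G (trunc k w, r) = G (w, r).
  by rewrite /G /alive_ind /nxt /= aliveE// /position /chosen truncE.
have E : (fun w => \int[round_prob Q]_r G (w, r)) = (fun w =>
  alive_ind w k * both_avg g w k).
  apply/funext => w.
  rewrite (round_integral (Q := Q) (m := round_prob Q) (bm_pair1 w bG))//.
  have bj b : bounded_measurable (fun z => g (pos w k + jump (chosen w k b) z)).
    by apply: (bm_move measurable_jump) => //; exact: chosen_sphere.
  by rewrite /G /nxt /= (bmE_Z Q _ (bj true)) (bmE_Z Q _ (bj false)) -mulrDr mulrCA.
split; first by rewrite -E; exact: bm_fubini.
transitivity (\int[P]_w G (w, w k)).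
  by apply: eq_Rintegral => w _; rewrite /G /nxt positionS.
by rewrite (iid_next_integral PQ bG GE) E.
Qed.

Variable th : R.
Hypothesis th01 : 0 <= th < 1.
Hypothesis exitD : forall z y, D z -> usphere y -> c \1_D z y <= th.

Let p k := \int[P]_w alive_ind w k.

Lemma alive_ind_ge0 w k : 0 <= alive_ind w k.
Proof. by rewrite /alive_ind; case: ifP. Qed.

Lemma alive_prob_ge0 k : 0 <= p k.
Proof. by apply: Rintegral_ge0 => w _; exact: alive_ind_ge0. Qed.

Lemma alive_probS k : p k.+1 <= th * p k.
Proof.
have [b1 E] := one_step k (bm_ind mD).
have -> : p k.+1 = \int[P]_w (alive_ind w k * \1_D (pos w k.+1)).
  apply: eq_Rintegral => w _; rewrite /alive_ind indicE /=.
  by case: (alive w k); rewrite ?mul0r// mul1r; case: (_ \in _).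
rewrite E -bmE_Z; last exact: bm_alive.
apply: bmE_le => // [|w]; first by apply: bmZ; exact: bm_alive.
rewrite mulrC /alive_ind; case: ifPn => al; last by rewrite !mulr0.
have Dp := alive_pos al (leqnn k).
have h1 := exitD Dp (chosen_sphere w k true);
  have h2 := exitD Dp (chosen_sphere w k false).
have two_gt0 : (0 : R) < 2 by [].
rewrite !mulr1 /both_avg (ler_pdivrMl _ _ two_gt0) mulr_natl mulr2n.
exact: lerD h1 h2.
Qed.

Lemma alive_prob_le k : p k <= th ^+ k.
Proof.
have th0 : 0 <= th by case/andP: th01.
elim: k => [|k IH].
  rewrite expr0 -(bmE_cst P 1); apply: bmE_le; [exact: bm_alive|exact: bm_cst|move=> w].
  by rewrite /alive_ind; case: ifP.
by rewrite (le_trans (alive_probS k))// exprS ler_wpM2l.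
Qed.

Variables (u : V -> R) (eta : R).
Hypotheses (bu : bounded_measurable u) (uF : forall z, ~ D z ->
  u z = F z) (eta0 : 0 <= eta).
Hypothesis near_opt : forall w k, D (pos w k) -> u (pos w k) - eta <= both_avg u w k.

(** The process moves only while the game is running, and then its expected
    increment is at least [- eta] by [near_opt]. *)
Lemma stopped_step k :
  \int[P]_w stopped u w k - eta * p k <= \int[P]_w stopped u w k.+1.
Proof.
have [b1 E] := one_step k bu.
have ba := bm_alive k.
have bs1 : bounded_measurable (fun w =>
  alive_ind w k * u (pos w k.+1)) by apply: bmM => //; exact: bm_pos.
have bs2 : bounded_measurable (fun w => alive_ind w k * u (pos w k)) by apply: bmM =>
  //; exact: bm_pos.
have -> : \int[P]_w stopped u w k.+1 =
   \int[P]_w stopped u w k + \int[P]_w (alive_ind w k * u (pos w k.+1)) - \int[P]_w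
     (alive_ind w k * u (pos w k)).
  rewrite -bmE_D//; last exact: bm_stopped.
  rewrite -bmE_B//; last by apply: bmD => //; exact: bm_stopped.
  apply: eq_Rintegral => w _ /=; rewrite /alive_ind; case: ifPn => al;
    last by rewrite !mul0r addr0 subr0.
  by rewrite stopped_alive// !mul1r addrC addKr.
rewrite -addrA lerD2l E lerBrDr addrC -bmE_Z// -bmE_B//; last exact: bmZ.
apply: bmE_le => // [|w]; first by apply: bmB => //; exact: bmZ.
rewrite /alive_ind; case: ifPn => al; last by rewrite !mul0r mulr0 subr0.
rewrite !mul1r mulr1; exact/near_opt/(alive_pos al).
Qed.

(** The losses of [stopped_step] add up to [eta * \sum_k p k], and
    [p k.+1 <= th * p k]; this summation is carried out by the induction on
    [u x - K + K * p k], in which [K * (p k - p k.+1) >= eta * p k]. *)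
Lemma payoff_ge : u x - eta / (1 - th) <= \int[P]_w payoff Rot eps x sI sII D F w.
Proof.
have [th0 th1] := andP th01.
have K0 : 0 < 1 - th by rewrite subr_gt0.
set K := eta / (1 - th).
have KE : K * (1 - th) = eta by rewrite /K divfK// gt_eqF.
have Kge0 : 0 <= K by rewrite divr_ge0// ltW.
have h k : u x - K + K * p k <= \int[P]_w stopped u w k.
  elim: k => [|k IH].
    rewrite bmE_cst -addrA gerDl addrC subr_le0 ler_piMr//.
    by have := alive_prob_le 0; rewrite expr0.
  apply: le_trans (stopped_step k).
  have : K * p k.+1 <= K * (th * p k) by rewrite ler_wpM2l// alive_probS.
  rewrite -KE; move: IH; set a := Rintegral _ _ _; set q := p k; set q' := p k.+1.
  by clearbody a q q' => h1 h2; have := h1; have := h2; nra.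
have [M uM] := bu.2; have [M' FM] := bF.2.
have M0 : 0 <= M := le_trans (normr_ge0 _) (uM 0).
have M'0 : 0 <= M' := le_trans (normr_ge0 _) (FM 0).
have payM w : `|payoff Rot eps x sI sII D F w| <= M'.
  by rewrite /payoff; case: exit_time => [k|]; rewrite ?normr0.
have bpay := bm_payoff.
have close k : \int[P]_w stopped u w k <= \int[P]_w payoff Rot eps x sI sII D F w +
  (M + M') * p k.
  rewrite -bmE_Z; last exact: bm_alive.
  rewrite -bmE_D//; last by apply: bmZ; exact: bm_alive.
  apply: bmE_le => [||w]; first exact: bm_stopped.
    by apply: bmD => //; apply: bmZ; exact: bm_alive.
  rewrite /alive_ind; case: ifPn => al; last by rewrite mulr0 addr0 (payoff_dead uF al).
  rewrite stopped_alive// mulr1; have := uM (pos w k); have := payM w.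
  by rewrite !ler_norml => /andP[h1 h2] /andP[h3 h4]; lra.
rewrite -subr_le0; apply: (@le_geometric0 _ _ (M + M') th) => // k.
have h1 := h k; have h2 := close k.
have h3 : (M + M') * p k <= (M + M') * th ^+ k by rewrite ler_wpM2l ?addr_ge0//
  alive_prob_le.
have h4 : 0 <= K * p k by rewrite mulr_ge0// alive_prob_ge0.
rewrite lerBlDr (le_trans _ (lerD h3 (lexx _)))//.
rewrite [leRHS]addrC (le_trans _ h2)// (le_trans _ h1)//.
by rewrite lerDl.
Qed.

End stopped.
End game.

(** * Values of the game *)

Section stationary.
Context {R : realType} {n : nat}.
Local Notation V := 'rV[R]_n.+2.
Local Notation round := (V * bool)%type.
Local Notation W := (seqspace round).
Local Notation history k := (V * k.-tuple (V * round))%type.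

Definition last_position k (h : history k) : V := last h.1 [seq r.1 | r <- h.2].

(** The last entry of the history records the current position, so a direction
    chosen as a function of the position defines a strategy. *)
Lemma last_position_hist Rot eps x sI sII (w : W) k :
  last_position (play Rot eps x sI sII w k).1 = position Rot eps x sI sII w k.
Proof.
case: k => // k; rewrite histS /last_position /=.
by rewrite map_rcons last_rcons.
Qed.

Lemma measurable_last_position k : measurable_fun setT (@last_position k).
Proof.
case: k => [|k].
  rewrite (_ : @last_position 0 = fst); first exact: measurable_fst.
  by apply/funext => h; rewrite /last_position tuple0.
rewrite (_ : @last_position k.+1 = fun h => (tnth h.2 ord_max).1); last first.
  apply/funext => h; rewrite /last_position (tnth_nth (last_position h, (0, true))) /=.
  rewrite (last_nth (last_position h)) size_map size_tuple /=.
  by rewrite (nth_map (last_position h, (0, true))) ?size_tuple.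
apply: (measurableT_comp (f := fst)) => //.
apply: (measurableT_comp (f := fun t => tnth t ord_max)) => //.
exact: measurable_tnth.
Qed.

Definition stationary (sel : V -> V) : @strategy R n := fun k h => sel (last_position h).

Lemma stationary_strategy sel : measurable_fun setT sel ->
  (forall z, usphere (sel z)) -> strategies (stationary sel).
Proof.
move=> ms sS k; split => [|h]; last exact: sS.
exact: (measurableT_comp ms (@measurable_last_position k)).
Qed.

End stationary.

Lemma half_sum_ge (R : realFieldType) (a b d e eta : R) : 0 <= eta ->
  a - eta <= d -> - e <= b -> 2^-1 * (a - b) - eta <= 2^-1 * (d + e).
Proof. by lra. Qed.

Section value.
Context {R : realType} {n : nat}.
Local Notation V := 'rV[R]_n.+2.
Local Notation round := (V * bool)%type.
Local Notation W := (seqspace round).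
Variables (Rot : V -> V -> 'M[R]_n.+2) (eps : R).
Hypothesis RotF : rotation_family Rot.
Variables (Q : probability V R) (P : probability W R) (D : set V).
Hypothesis PQ : iid_law P (round_prob Q).
Hypothesis mD : measurable D.
Local Notation c := (move_avg Q (jump Rot eps)).
Variables (yd : nat -> V) (th : R).
Hypothesis ydS : forall j, usphere (yd j).
Hypothesis c_approx : forall (u : V ->
  R) (x y : V) (eta : R), bounded_measurable u -> usphere y -> 0 < eta ->
  exists j, `|c u x (yd j) - c u x y| < eta.
Hypothesis th01 : 0 <= th < 1.
Hypothesis exitD : forall z y, D z -> usphere y -> c \1_D z y <= th.
Local Notation S := (@usphere R n.+2).
Local Notation tug := (tug_avg Q S (jump Rot eps)).

(** The almost optimal direction [y1] accounts for the supremum up to [eta], any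
    direction [y2] of the opponent for the infimum. *)
Lemma tug_near_opt (u : V -> R) (eta : R) z y1 y2 :
  bounded_measurable u -> 0 <= eta -> usphere y1 -> usphere y2 ->
  sup_avg Q S (jump Rot eps) u z - eta <= c u z y1 ->
  tug u z - eta <= 2^-1 * (c u z y1 + c u z y2).
Proof.
move=> bu eta0 S1 S2 h1.
have mj y : usphere y -> measurable_fun setT (jump Rot eps y) by exact: measurable_jump.
rewrite (tug_avgE Q mj)//.
have h2 := sup_avg_ge Q mj z (bmN bu) S2; rewrite (move_avgN Q mj z bu S2) in h2.
exact: half_sum_ge h1 h2.
Qed.

Variables (F u : V -> R).
Hypothesis bF : bounded_measurable F.
Hypothesis su : dpp_sol Q S (jump Rot eps) D F u.

Lemma payoff_opp x sI sII w :
  payoff Rot eps x sI sII D (fun z => - F z) w = - payoff Rot eps x sI sII D F w.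
Proof. by rewrite /payoff; case: exit_time => [k|]; rewrite ?oppr0. Qed.

Lemma expected_payoffE x sI sII : strategies sI -> strategies sII ->
  expected_payoff P Rot eps D F x sI sII = (\int[P]_w payoff Rot eps x sI sII D F w)%:E.
Proof.
by move=> hI hII; rewrite /expected_payoff unlock bmE_fin//; exact: bm_payoff.
Qed.

Lemma player_I_secures e : 0 < e -> exists2 sI, strategies sI &
  forall x sII, strategies sII -> ((u x - e)%:E <= expected_payoff P Rot eps D F x sI
    sII)%E.
Proof.
move=> e0; have [bu uD uF] := su.
have mj y : usphere y -> measurable_fun setT (jump Rot eps y) by exact: measurable_jump.
have t0 : 0 < 1 - th by rewrite subr_gt0; case/andP: th01.
have eta0 : 0 < e * (1 - th) by rewrite mulr_gt0.
have [sel [msel selS selP]] := near_optimal mj ydS c_approx bu eta0.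
have hI := stationary_strategy msel selS.
exists (stationary sel) => // x sII hII; rewrite expected_payoffE// lee_fin.
have := @payoff_ge _ _ Rot eps x RotF _ _ hI hII Q P D F PQ mD bF th th01 exitD u (e
  * (1 - th)) bu uF (ltW eta0).
rewrite mulfK ?gt_eqF//; apply => w k Dw; rewrite uD//.
have S1 := chosen_sphere Rot eps x hI hII w k true.
have S2 := chosen_sphere Rot eps x hI hII w k false.
apply: (tug_near_opt bu (ltW eta0) S1 S2).
by rewrite /chosen /stationary last_position_hist.
Qed.

(** The statement for the first player with [u] and [F] replaced by [- u] and
    [- F], which solve the same equation. *)
Lemma player_II_secures e : 0 < e -> exists2 sII, strategies sII &
  forall x sI, strategies sI -> (expected_payoff P Rot eps D F x sI sII <= (u x +
    e)%:E)%E.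
Proof.
move=> e0; have [bu uD uF] := su.
have mj y : usphere y -> measurable_fun setT (jump Rot eps y) by exact: measurable_jump.
have t0 : 0 < 1 - th by rewrite subr_gt0; case/andP: th01.
have eta0 : 0 < e * (1 - th) by rewrite mulr_gt0.
have [sel [msel selS selP]] := near_optimal mj ydS c_approx (bmN bu) eta0.
have hII := stationary_strategy msel selS.
exists (stationary sel) => // x sI hI; rewrite expected_payoffE// lee_fin.
have uFN z : ~ D z -> - u z = - F z by move=> /uF ->.
have := @payoff_ge _ _ Rot eps x RotF _ _ hI hII Q P D _ PQ mD (bmN bF) th th01 exitD
  _ (e * (1 - th)) (bmN bu) uFN (ltW eta0).
rewrite mulfK ?gt_eqF//.
under eq_Rintegral do rewrite payoff_opp.
rewrite bmE_N; last exact: bm_payoff.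
rewrite -opprD lerN2; apply => w k Dw; rewrite uD// -(tug_avgN Q mj)//.
rewrite /both_avg [X in 2^-1 * X]addrC;
  have S1 := chosen_sphere Rot eps x hI hII w k true.
have S2 := chosen_sphere Rot eps x hI hII w k false.
apply: (tug_near_opt (bmN bu) (ltW eta0) S2 S1).
by rewrite /chosen /stationary last_position_hist.
Qed.

Lemma game_values x :
  value_I P Rot eps D F x = (u x)%:E /\ value_II P Rot eps D F x = (u x)%:E.
Proof.
have low : ((u x)%:E <= value_I P Rot eps D F x)%E.
  apply/lee_addgt0Pr => e e0; have [sI hI sIP] := player_I_secures e0.
  rewrite -leeBlDr// -EFinB /value_I.
  apply: le_trans (ereal_sup_ubound _); last by exists sI.
  by apply: le_ereal_inf_tmp => _ [sII hII <-]; exact: sIP.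
have upp : (value_II P Rot eps D F x <= (u x)%:E)%E.
  apply/lee_addgt0Pr => e e0; have [sII hII sIIP] := player_II_secures e0.
  rewrite -EFinD /value_II.
  apply: le_trans (ereal_inf_lbound _) _; first by exists sII.
  by apply: ge_ereal_sup => _ [sI hI <-]; exact: sIIP.
have mid : (value_I P Rot eps D F x <= value_II P Rot eps D F x)%E.
  apply: ge_ereal_sup => _ [sI hI <-]; apply: le_ereal_inf_tmp => _ [sII hII <-].
  apply: le_trans (ereal_inf_lbound _) (ereal_sup_ubound _); last by exists sI.
  by exists sII.
by split; apply/eqP; rewrite eq_le ?low ?upp ?(le_trans mid upp) ?(le_trans low mid).
Qed.

End value.

Section bounded.
Context {R : realType} {d} {T : measurableType d}.

Lemma bounded_measurableP (f : T ->
  R) : bounded_measurable f <-> bounded_fun f /\ measurable_fun setT f.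
Proof.
split=> [[mf [M fM]]|[[M [_ fM]] mf]]; split => //.
  exists M; split; first exact: num_real.
  by move=> y My x _ /=; rewrite (le_trans (fM x))// ltW.
exists (M + 1) => x; apply: fM => //; by rewrite ltrDl.
Qed.

End bounded.

Section cone_game.
Context {R : realType} {n : nat}.
Local Notation V := 'rV[R]_n.+2.
Variables (alpha : R) (s : {posnum R}).
Variable Rot : V -> V -> 'M[R]_n.+2.
Hypothesis RotF : rotation_family Rot.
Variable eps : R.
Hypothesis eps0 : 0 < eps.
Hypothesis alpha_itv : 0 < alpha <= pi.
Hypothesis JT : @jump_law R n alpha s setT = 1%E.
Local Notation Q := (jump_prob JT).
Local Notation S := (@usphere R n.+2).
Local Notation c := (move_avg Q (jump Rot eps)).

Lemma Rot_orthogonal (y : V) : usphere y ->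
  Rot y e1 *m (Rot y e1)^T = 1%:M /\ mxact (Rot y e1) e1 = y.
Proof. by move=> xS; have [[]] := RotF xS e1_sphere. Qed.

Lemma bm_shift (u : V -> R) (x : V) : bounded_measurable u ->
  bounded_measurable (fun z : V => u (x + z)).
Proof.
by move=> bu; apply: (bm_comp bu); exact: measurable_rVD.
Qed.

Lemma cone_avgE (u : V -> R) x y : bounded_measurable u -> usphere y ->
  cone_avg alpha s eps u x y = c u x y.
Proof.
move=> bu yS; rewrite /cone_avg (mu_avgE JT eps0 (Rot_orthogonal yS).1
  (Rot_orthogonal yS).2)//.
exact: bm_shift.
Qed.

Lemma A_opE (u : V -> R) x : bounded_measurable u ->
  A_op alpha s eps u x = tug_avg Q S (jump Rot eps) u x.
Proof.
move=> bu; rewrite /A_op /tug_avg /sup_avg /inf_avg.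
rewrite (_ : [set cone_avg alpha s eps u x y | y in S] = [set c u x y | y in S])//.
by apply/seteqP; split => _ [y yS <-]; exists y => //; rewrite cone_avgE.
Qed.

Lemma dpp_solutionP D F u :
  dpp_solution alpha s eps D F u <-> dpp_sol Q S (jump Rot eps) D F u.
Proof.
split=> [[b m uD uF]|[bu uD uF]].
  have bu : bounded_measurable u by apply/bounded_measurableP.
  by split => // x Dx; rewrite uD// A_opE.
by have [b m] := (bounded_measurableP u).1 bu; split => // x Dx; rewrite A_opE// -uD.
Qed.

Lemma move_avg_approx (u : V -> R) x y eta : bounded_measurable u -> usphere y ->
  0 < eta ->
  exists j, `|c u x (rat_direction j) - c u x y| < eta.
Proof.
move=> bu yS eta0.
have [j jP] := cone_avg_approx JT alpha_itv RotF eps0 (bm_shift x bu) yS eta0.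
exists j; move: jP; rewrite -/(cone_avg alpha s eps u x (rat_direction j)).
rewrite -/(cone_avg alpha s eps u x y) !cone_avgE//; exact: rat_direction_sphere.
Qed.

(** Two points of [D] differ by at most [2 * (|M| + 1)] in each coordinate, so a
    jump of norm larger than [r] leaves [D]. *)
Lemma exit_prob (D : set V) : measurable D -> bounded_set D ->
  exists2 th, 0 <= th < 1 & forall x y, D x -> usphere y -> c \1_D x y <= th.
Proof.
move=> mD [M [_ DM]].
have DM' x : D x -> `|x| <= M + 1 by apply: DM; rewrite ltrDl.
pose r := n.+2%:R * (2 * (`|M| + 1)) / eps.
have [t t0 tP] := jump_far JT r.
have mA : measurable [set z : V | r < enorm z].
  rewrite (_ : mkset _ = (@enorm R n.+2) @^-1` `]r, +oo[).
    by rewrite -[X in measurable X]setTI; exact: measurable_enorm.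
  by apply/seteqP; split => x /=; rewrite in_itv/= andbT.
have QA : Q [set z : V | r < enorm z] = (fine (Q [set z : V | r < enorm z]))%:E.
  by rewrite fineK// fin_num_measure.
have t1 : t <= fine (Q [set z : V | r < enorm z]) by rewrite -lee_fin -QA.
have q1 : fine (Q [set z : V | r < enorm z]) <= 1 by rewrite -lee_fin -QA probability_le1.
exists (1 - t); first by rewrite subr_ge0 (le_trans t1 q1) ltrBlDr ltrDl.
move=> x y Dx yS.
have mj : measurable_fun setT (jump Rot eps y) by exact: measurable_jump.
have bA : bounded_measurable (\1_[set z : V | r < enorm z] : V -> R) by exact: bm_ind.
apply: (@le_trans _ _ (\int[Q]_z (1 - \1_[set z : V | r < enorm z] z))).
  apply: bmE_le.
  - apply: (bm_comp (h := fun z => x + jump Rot eps y z) (bm_ind mD)).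
    exact: measurable_rVD.
  - by apply: bmB => //; exact: bm_cst.
  move=> z; rewrite !indicE; case: (boolP (z \in _)) => [/set_mem rz|_] /=; last first.
    by rewrite subr0; case: (_ \in _).
  rewrite subrr; case: (boolP (_ \in D)) => // /set_mem Dz; exfalso.
  have : enorm (jump Rot eps y z) <= n.+2%:R * (2 * (`|M| + 1)).
    apply: enorm_le_coord => [|i]; first by rewrite mulr_ge0// addr_ge0.
    have cb (v : V) : D v -> `|v ord0 i| <= `|M| + 1.
      move=> Dv; rewrite (le_trans (coord_le_norm v i))// (le_trans (DM' _ Dv))//.
      by rewrite lerD2r ler_norm.
    have -> : jump Rot eps y z ord0 i = (x + jump Rot eps y z) ord0 i - x ord0 i.
      by move: (jump Rot eps y z) => J; rewrite mxE addrC addKr.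
    rewrite (le_trans (ler_normB _ _))// mulr_natl mulr2n.
    by rewrite lerD//; exact: cb.
  rewrite leNgt => /negP; apply.
  rewrite /jump -/(similarity eps (Rot y e1) z) (enorm_similarity eps0
    (Rot_orthogonal yS).1).
  by rewrite [ltRHS]mulrC -ltr_pdivrMr.
rewrite bmE_B//; last exact: bm_cst.
rewrite bmE_cst lerD2l lerN2 (le_trans t1)//.
by rewrite /Rintegral integral_indic// setIT.
Qed.

End cone_game.

Lemma unif_continuous_continuous (U V : uniformType) (f : U -> V) :
  unif_continuous f -> continuous f.
Proof.
move=> uf x; apply/(cvg_entourageP (fmap_filter f (nbhs_filter x))) => E /uf entE.
have := nbhs_entourage x entE; rewrite /xsection.
by apply: filterS => y /=; rewrite inE.
Qed.

Theorem lemma7p1 (R : realType) (n : nat) (p : R) (s : {posnum R}) (alpha : R)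
    (Rot : 'rV[R]_n.+2 -> 'rV[R]_n.+2 -> 'M[R]_n.+2)
    (P : probability (seqspace ('rV[R]_n.+2 * bool)) R)
    (D : set 'rV[R]_n.+2) (F : 'rV[R]_n.+2 -> R) :
  2 <= p ->
  2^-1 < s%:num < 1 ->
  @p_angle R n p alpha ->
  rotation_family Rot ->
  iid_law P (round_law alpha s) ->
  open D -> bounded_set D ->
  bounded_fun F -> unif_continuous F ->
  \forall eps \near 0^'+,
    exists u : 'rV[R]_n.+2 -> R,
      [/\ dpp_solution alpha s eps D F u,
          forall v, dpp_solution alpha s eps D F v -> v = u,
          forall x, value_I P Rot eps D F x = (u x)%:E &
          forall x, value_II P Rot eps D F x = (u x)%:E].
Proof.
move=> _ _ [/andP[alpha0 alpha_le] _] RotF PQ oD bD bF uF.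
near=> eps.
have eps0 : 0 < eps by near: eps; exact: nbhs_right_gt.
have alpha_itv : 0 < alpha <= pi.
  by rewrite alpha0 (le_trans alpha_le)// ler_pdivrMr// ler_peMr ?pi_ge0// ler1n.
have JT : @jump_law R n alpha s setT = 1%E.
  (* The first round has a law of total mass one. *)
  have := PQ 1%N (fun _ => setT) (fun _ => measurableT).
  rewrite big_ord_recl big_ord0 mule1 (_ : [set w | _] = setT); last first.
    by apply/seteqP; split.
  rewrite probability_setT => h.
  have B1 : bernoulli_prob (2^-1 : R) setT = 1%E by exact: probability_setT.
  have := product_measure1E (@jump_law R n alpha s) (bernoulli_prob (2^-1 : R))
    measurableT measurableT.
  by rewrite setXTT [X in (_ * X)%E]B1 mule1 => <-; rewrite h.
have mD : measurable D by exact: rV_open_measurable.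
have bmF : bounded_measurable F.
  apply/bounded_measurableP; split => //; apply: rV_continuous_measurable.
  exact: unif_continuous_continuous.
have PQ' : iid_law P (round_prob (jump_prob JT)) by exact: PQ.
have [th th01 exitD] := exit_prob RotF eps0 JT mD bD.
have mj y : usphere y -> measurable_fun setT (jump Rot eps y) by exact: measurable_jump.
have approx := move_avg_approx RotF eps0 alpha_itv JT.
have ydS := @rat_direction_sphere R n.
have [u su] := dpp_exists mj ydS approx mD th01 exitD bmF.
have solP := dpp_solutionP RotF eps0 JT D F.
exists u; split.
- exact/solP.
- move=> v /solP sv; apply/funext => x; apply/eqP; rewrite eq_le.
  by rewrite (dpp_unique mj ydS mD th01 exitD sv su) (dpp_unique mj ydS mD th01 exitD
    su sv).
- by move=> x; have [] := game_values RotF PQ' mD ydS approx th01 exitD bmF su x.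
- by move=> x; have [] := game_values RotF PQ' mD ydS approx th01 exitD bmF su x.
Unshelve. all: by end_near.
Qed.
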